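(* The axioms (V4) and (V5) of an $(n,N)$-cohomological vertex algebra may be replaced by skew-symmetry and weak associativity. That is: let $(V,Y,e^{\mathbf z\cdot\mathbf T},|0\rangle)$ be data as in the definition of an $(n,N)$-cohomological vertex algebra over a commutative ring $R$, satisfying axioms (V1), (V2), (V3). Then (V4) and (V5) hold if and only if both of the following hold: (i) (skew-symmetry) $Y(a,\mathbf z)b=p(a,b)e^{\mathbf z\cdot\mathbf T}Y(b,-\mathbf z)a$ for all homogeneous $a,b\in V$; (ii) (weak associativity) for all $a,c\in V$ and all $b\in V$ the series $Y(a,\mathbf z-\mathbf w)Y(b,-\mathbf w)c-Y(Y(a,\mathbf z)b,-\mathbf w)c$ is local for the pair $(\mathbf z,\mathbf w)$, with the number of terms in the local expansion (the bound $\mathbf K$ in the definition of locality) uniformly bounded for all $b\in V$, for given $a,c$.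
   Context: Fix a commutative ring $R$ and integers $N,n$ with $n\ge1$; $\mathbb N=\{0,1,2,\dots\}$. Bold letters are $n$-tuples: variables $\mathbf z=(z_1,\dots,z_n)$, multi-indices in $\mathbb N^n$; $\mathbf 0,\mathbf 1$ are constant tuples; $\mathbf k\ge\mathbf j$ is componentwise; $|\mathbf k|=\sum k_i$; $\mathbf z^{\mathbf k}=\prod z_i^{k_i}$; $\binom{\mathbf k}{\mathbf j}=\prod\binom{k_i}{j_i}$. For a $\mathbb Z$-graded $R$-module, $p(a)$ is the degree of a homogeneous element and $p(a,b)=(-1)^{p(a)p(b)}$. Formal calculus. $\mathcal K^{\mathbf z}_{\mathrm{dist}}(V)$ is the graded $R$-module of series $A(\mathbf z)=\sum_{\mathbf k\ge\mathbf 0}(\mathbf z^{\mathbf k}A_{-\mathbf 1-\mathbf k}+\Omega^{\mathbf k}_{\mathbf z}A_{\mathbf k})$ with coefficients in $V$, where the $z_i$ have degree $0$ and the symbols $\Omega_{\mathbf z}^{\mathbf k}$ have degree $N$; $V\langle\!\langle\mathbf z\rangle\!\rangle$ is the submodule of series for which there is $\mathbf K$ with $A_{\mathbf k}=0$ unless $\mathbf k\le\mathbf K$. $\mathcal K^{\mathbf z,\mathbf w}_{\mathrm{dist}}(V)$ consists of all formal series in $\mathbf z^{\mathbf j}\mathbf w^{\mathbf k}$, $\mathbf z^{\mathbf j}\Omega^{\mathbf k}_{\mathbf w}$, $\mathbf w^{\mathbf j}\Omega^{\mathbf k}_{\mathbf z}$, $\Omega^{\mathbf j}_{\mathbf z}\Omega^{\mathbf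 k}_{\mathbf w}$. Products (when no infinite sums of coefficients occur) are given by $\mathbf z^{\mathbf j}\Omega^{\mathbf k}_{\mathbf z}=\Omega^{\mathbf k-\mathbf j}_{\mathbf z}$ if $\mathbf k\ge\mathbf j$ and $0$ otherwise, $\Omega^{\mathbf j}_{\mathbf z}\Omega^{\mathbf k}_{\mathbf z}=0$, $\Omega^{\mathbf j}_{\mathbf z}\Omega^{\mathbf k}_{\mathbf w}=(-1)^N\Omega^{\mathbf k}_{\mathbf w}\Omega^{\mathbf j}_{\mathbf z}$, variables commute with everything, and a homogeneous coefficient $a$ satisfies $a\Omega=(-1)^{p(a)N}\Omega a$. Hasse derivatives: $\partial^{(\mathbf j)}_{\mathbf z}\mathbf z^{\mathbf k}=\binom{\mathbf k}{\mathbf j}\mathbf z^{\mathbf k-\mathbf j}$, $\partial^{(\mathbf j)}_{\mathbf z}\Omega^{\mathbf k}_{\mathbf z}=(-1)^{|\mathbf j|}\binom{\mathbf k+\mathbf j}{\mathbf j}\Omega^{\mathbf k+\mathbf j}_{\mathbf z}$; in a product $\partial^{(\mathbf k)}FG$ the derivative acts on $F$ only. Residue: $\operatorname{Res}_{\mathbf z}(\mathbf z^{\mathbf j}f(\mathbf w))=0$, $\operatorname{Res}_{\mathbf z}(\Omega^{\mathbf j}_{\mathbf z}f(\mathbf w))=\delta_{\mathbf j,\mathbf 0}f(\mathbf w)$. $\Delta(\mathbf z,\mathbf w)=\sum_{\mathbf j\ge\mathbf 0}\big(\mathbf w^{\mathbf j}\Omega^{\mathbf j}_{\mathbf z}+(-1)^N\mathbf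 z^{\mathbf j}\Omega^{\mathbf j}_{\mathbf w}\big)$. Convention: $\Omega^{\mathbf m}_{-\mathbf z}=(-1)^{|\mathbf m|+N+1}\Omega^{\mathbf m}_{\mathbf z}$; for a series $A$, $A(-\mathbf z)$ is obtained by replacing $\mathbf z^{\mathbf k}$ by $(-1)^{|\mathbf k|}\mathbf z^{\mathbf k}$ and $\Omega^{\mathbf k}_{\mathbf z}$ by $\Omega^{\mathbf k}_{-\mathbf z}$. Fields. A cohomological field on $V$ is $A(\mathbf z)=\sum_{\mathbf j}(\mathbf z^{\mathbf j}A_{(-\mathbf 1-\mathbf j)}+\Omega^{\mathbf j}_{\mathbf z}A_{(\mathbf j)})\in\mathcal K^{\mathbf z}_{\mathrm{dist}}(\operatorname{End}V)$ with $A(\mathbf z)v\in V\langle\!\langle\mathbf z\rangle\!\rangle$ for all $v$; it is homogeneous of degree $p(A)$ if each $A_{(-\mathbf 1-\mathbf j)}$ has degree $p(A)$ and each $A_{(\mathbf j)}$ has degree $p(A)-N$. $[A(\mathbf z),B(\mathbf w)]=A(\mathbf z)B(\mathbf w)-p(A,B)B(\mathbf w)A(\mathbf z)$. A series $f(\mathbf z,\mathbf w)$ is local if $f=\sum_{\mathbf 0\le\mathbf j\le\mathbf K}\partial^{(\mathbf j)}_{\mathbf w}\Delta(\mathbf z,\mathbf w)g^{\mathbf j}(\mathbf w)$ for some $\mathbf K\in\mathbb N^n$, with $g^{\mathbf j}(\mathbf w)=\operatorname{Res}_{\mathbf z}((\mathbf z-\mathbf w)^{\mathbf j}f)$. Fields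 $A,B$ are mutually local if $[A(\mathbf z),B(\mathbf w)]\in\mathcal K^{\mathbf z,\mathbf w}_{\mathrm{dist}}(\operatorname{End}V)$ is local. An $(n,N)$-cohomological vertex algebra (CVA) over $R$ consists of the data $(V,Y,e^{\mathbf z\cdot\mathbf T},|0\rangle)$: a $\mathbb Z$-graded $R$-module $V$; a degree $0$ $R$-linear map $Y$, $a\mapsto Y(a,\mathbf z)=\sum_{\mathbf j}(\mathbf z^{\mathbf j}a_{(-\mathbf 1-\mathbf j)}+\Omega^{\mathbf j}_{\mathbf z}a_{(\mathbf j)})\in\mathcal K^{\mathbf z}_{\mathrm{dist}}(\operatorname{End}V)$ (for homogeneous $a$, $a_{(-\mathbf 1-\mathbf j)}$ has degree $p(a)$ and $a_{(\mathbf j)}$ degree $p(a)-N$); degree $0$ endomorphisms $T^{(\mathbf j)}$, $\mathbf j\ge\mathbf 0$, with $T^{(\mathbf 0)}=\mathrm{id}_V$, assembled as $e^{\mathbf z\cdot\mathbf T}=\sum_{\mathbf j}\mathbf z^{\mathbf j}T^{(\mathbf j)}$; and a vacuum $|0\rangle\in V^0$; satisfying for all $a,b\in V$: (V1) $Y(a,\mathbf z)b\in V\langle\!\langle\mathbf z\rangle\!\rangle$; (V2) $Y(|0\rangle,\mathbf z)=\mathrm{id}_V$; (V3) $Y(a,\mathbf z)|0\rangle=e^{\mathbf z\cdot\mathbf T}a$; (V4) $e^{\mathbf w\cdot\mathbf T}Y(a,\mathbf z)e^{-\mathbf w\cdot\mathbf T}=Y(a,\mathbf z+\mathbf w):=\sum_{\mathbf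 k}\mathbf w^{\mathbf k}\partial^{(\mathbf k)}_{\mathbf z}Y(a,\mathbf z)$; (V5) for homogeneous $a,b$, $Y(a,\mathbf z)$ and $Y(b,\mathbf w)$ are mutually local. Further notation: $Y(a,\mathbf z-\mathbf w)=\sum_{\mathbf k}(-1)^{|\mathbf k|}\mathbf w^{\mathbf k}\partial^{(\mathbf k)}_{\mathbf z}Y(a,\mathbf z)$, and $Y(Y(a,\mathbf z)b,\mathbf w)=\sum_{\mathbf k\ge\mathbf 0}\big(\mathbf z^{\mathbf k}Y(a_{(-\mathbf 1-\mathbf k)}b,\mathbf w)+\Omega^{\mathbf k}_{\mathbf z}Y(a_{(\mathbf k)}b,\mathbf w)\big)$. *)

(* Defs.v *)
From HB Require Import structures.
From mathcomp Require Import all_boot all_order all_algebra.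
From mathcomp Require Import boolp classical_sets cardinality fsbigop.
From mathcomp Require Import mpoly.

Set Implicit Arguments.
Unset Strict Implicit.
Unset Printing Implicit Defensive.

Import GRing.Theory.

Local Open Scope classical_set_scope.
Local Open Scope ring_scope.

(* A Z-grading of an R-module, given by the projections v |-> v_d onto the
   degree d components; each v is the (finite) sum of its components. *)
HB.mixin Record isGraded (R : comPzRingType) V of GRing.Lmodule R V := {
  gcomp : int -> {linear V -> V};
  gcompE : forall (d e : int) (v : V),
    gcomp d (gcomp e v) = if d == e then gcomp e v else 0;
  gcomp_sum : forall v : V, exists s : seq int,
    uniq s /\ v = \sum_(d <- s) gcomp d v }.

#[short(type="gradedLmodType")]
HB.structure Definition GradedLmodule (R : comPzRingType) :=
  {V of isGraded R V & GRing.Lmodule R V}.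

Definition has_degree (R : comPzRingType) (V : gradedLmodType R) (d : int) (v : V)
  : Prop := gcomp d v = v.

(* (-1)^d *)
Definition ksign (R : comPzRingType) (d : int) : R := (-1) ^+ `|d|%N.

(* Throughout, sums over [set: _] are finitely supported sums: products of
   series are only used when no infinite sum of coefficients occurs. *)

Section Koszul.
Context (R : comPzRingType) (V : gradedLmodType R) (N : int).

(* v |-> (-1)^(p(v) N) v *)
Definition koszul (v : V) : V :=
  \sum_(d \in [set: int]) ksign R (d * N) *: gcomp d v.

(* phi Omega = Omega (twist phi): for phi of degree p this is
   phi |-> (-1)^(p N) phi, extended additively to all operators. *)
Definition twist (phi : V -> V) : V -> V := koszul \o phi \o koszul.

End Koszul.

(* inl k encodes z^k and inr k encodes Omega_z^k. *)
Definition sym (n : nat) : choiceType := ('X_{1..n} + 'X_{1..n})%type.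

Definition isOmega n (s : sym n) : bool := if s is inr _ then true else false.

(* series1 n M is K_dist^z(M): f s is the coefficient of s.
   series2 n M is K_dist^{z,w}(M): f s t is the coefficient of s_z t_w, where
   the symbol in z is written first and the coefficient last. *)
Definition series1 (n : nat) (M : Type) : Type := sym n -> M.
Definition series2 (n : nat) (M : Type) : Type := sym n -> sym n -> M.

Definition mbin n (k j : 'X_{1..n}) : nat := \prod_(i < n) 'C(k i, j i).

Section Series.
Context (R : comPzRingType) (n : nat) (N : int) (M : lmodType R).

Definition inz (f : series1 n M) : series2 n M :=
  fun s t => if t == inl 0%MM then f s else 0.

Definition inw (f : series1 n M) : series2 n M :=
  fun s t => if s == inl 0%MM then f t else 0.

(* M<<z>> *)
Definition lower_bounded (f : series1 n M) : Prop :=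
  exists K : 'X_{1..n}, forall k, ~~ (k <= K)%MM -> f (inr k) = 0.

(* f(-z), with Omega_{-z}^m = (-1)^(|m| + N + 1) Omega_z^m *)
Definition negz (f : series1 n M) : series1 n M := fun s =>
  match s with
  | inl k => (-1) ^+ mdeg k *: f (inl k)
  | inr k => ((-1) ^+ mdeg k * ksign R (N + 1)) *: f (inr k)
  end.

Definition hasse (j : 'X_{1..n}) (f : series1 n M) : series1 n M := fun s =>
  match s with
  | inl k => f (inl (k + j)%MM) *+ mbin (k + j)%MM j
  | inr k => if (j <= k)%MM
             then (-1) ^+ mdeg j *: (f (inr (k - j)%MM) *+ mbin k j) else 0
  end.

(* Left multiplication by a symbol, from the table
     z^j z^k = z^(j + k),   Omega^j Omega^k = 0,
     z^j Omega^k = Omega^k z^j = Omega^(k - j) if j <= k, and 0 otherwise. *)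
Definition mulsym (s : sym n) (f : series1 n M) : series1 n M := fun t =>
  match s, t with
  | inl j, inl k => if (j <= k)%MM then f (inl (k - j)%MM) else 0
  | inl j, inr k => f (inr (k + j)%MM)
  | inr j, inr k => if (k <= j)%MM then f (inl (j - k)%MM) else 0
  | inr _, inl _ => 0
  end.

(* Left multiplication by u_z v_w; the sign is that of
   Omega_w Omega_z = (-1)^N Omega_z Omega_w. *)
Definition mulmon (u v : sym n) (f : series2 n M) : series2 n M := fun s t =>
  mulsym u (fun s' => mulsym v (fun t' =>
    (if isOmega v && isOmega s' then ksign R N else 1) *: f s' t') t) s.

(* Product of a series with scalar coefficients (which have degree 0, so
   commute with everything) and an M-valued series. *)
Definition scale2 (c : series2 n R) (f : series2 n M) : series2 n M :=
  fun s t => \sum_(u \in [set: sym n * sym n])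
    mulmon u.1 u.2 (fun s' t' => c u.1 u.2 *: f s' t') s t.

Definition Res (f : series2 n M) : series1 n M := fun t => f (inr 0%MM) t.

End Series.

Section Locality.
Context (R : comPzRingType) (n : nat) (N : int).

Definition Delta : series2 n R := fun s t =>
  match s, t with
  | inr j, inl k => (j == k)%:R
  | inl j, inr k => ksign R N * (j == k)%:R
  | _, _ => 0
  end.

Definition hasse_Delta (j : 'X_{1..n}) : series2 n R :=
  fun s => hasse (M := R^o) j (Delta s).

(* (z - w)^j = \sum_(i + k = j) (-1)^|k| binom(j, i) z^i w^k *)
Definition subX (j : 'X_{1..n}) : series2 n R := fun s t =>
  match s, t with
  | inl i, inl k => if (i + k)%MM == j then (-1) ^+ mdeg k *+ mbin j i else 0
  | _, _ => 0
  end.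

Definition local_upto (M : lmodType R) (K : 'X_{1..n}) (f : series2 n M)
  : Prop :=
  forall s t, f s t =
    \sum_(j : 'X_{1..n < (mdeg K).+1} | (j <= K)%MM)
      scale2 N (hasse_Delta j) (inw (Res (scale2 N (subX j) f))) s t.

End Locality.

(* Series whose coefficients are operators on V. *)
Section OpSeries.
Context (R : comPzRingType) (V : gradedLmodType R) (n : nat) (N : int).

Definition apply1 (A : series1 n (V -> V)) (v : V) : series1 n V :=
  fun s => A s v.

Definition op_inz (A : series1 n (V -> V)) : series2 n (V -> V) :=
  fun s t v => inz (apply1 A v) s t.

Definition op_inw (A : series1 n (V -> V)) : series2 n (V -> V) :=
  fun s t v => inw (apply1 A v) s t.

(* Products of an operator-valued and a V-valued series: moving each Omega of
   the right factor to the left of an operator coefficient twists the latter. *)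
Definition mul1 (F : series1 n (V -> V)) (g : series1 n V) : series1 n V :=
  fun s => \sum_(u \in [set: sym n])
    mulsym u (fun s' => iter (isOmega s') (twist N) (F u) (g s')) s.

Definition mul2 (F : series2 n (V -> V)) (g : series2 n V) : series2 n V :=
  fun s t => \sum_(u \in [set: sym n * sym n])
    mulmon N u.1 u.2 (fun s' t' =>
      iter (isOmega s' + isOmega t') (twist N) (F u.1 u.2) (g s' t')) s t.

Definition cohomological_field (A : series1 n (V -> V)) : Prop :=
  forall v, lower_bounded (apply1 A v).

(* [A(z), B(w)] v, for A and B homogeneous of degrees p and q *)
Definition commutator (p q : int) (A B : series1 n (V -> V)) (v : V)
  : series2 n V := fun s t =>
  mul2 (op_inz A) (inw (apply1 B v)) s t
  - ksign R (p * q) *: mul2 (op_inw B) (inz (apply1 A v)) s t.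

(* Locality of [A(z), B(w)] as an identity of End(V)-valued series: the bound
   K does not depend on the vector at which operators are evaluated. *)
Definition mutually_local (p q : int) (A B : series1 n (V -> V)) : Prop :=
  exists K : 'X_{1..n}, forall v, local_upto N K (commutator p q A B v).

End OpSeries.

(* (V, Y, e^{z.T}, |0>), with Y(a, z) b = \sum_s s (vop a s b), so that
   vop (inl j) a = a_(-1-j) and vop (inr j) a = a_(j); Top j is T^(j). *)
Record cva_data (R : comPzRingType) (n : nat) (N : int) := CVAData {
  cva_mod :> gradedLmodType R;
  vop : cva_mod -> sym n -> {linear cva_mod -> cva_mod};
  vop_linear : forall (s : sym n) (b : cva_mod), linear (fun a => vop a s b);
  Top : 'X_{1..n} -> {linear cva_mod -> cva_mod};
  vac : cva_mod;
  vop_homog : forall (s : sym n) (p q : int) (a b : cva_mod),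
    has_degree p a -> has_degree q b ->
    has_degree (p + q - (if isOmega s then N else 0)) (vop a s b);
  Top_homog : forall (j : 'X_{1..n}) (p : int) (a : cva_mod),
    has_degree p a -> has_degree p (Top j a);
  Top0 : forall a : cva_mod, Top 0%MM a = a;
  vac_homog : has_degree 0 vac }.

Section CVA.
Context (R : comPzRingType) (n : nat) (N : int) (V : cva_data R n N).
Implicit Types a b c : V.

Definition Y a : series1 n (V -> V) := fun s b => vop a s b.

Definition expT : series1 n (V -> V) := fun s a =>
  if s is inl j then Top V j a else 0.

(* e^{-z.T} a *)
Definition expNT_at a : series1 n V := negz N (apply1 expT a).

(* Y(a, z + w) and Y(a, z - w), expanded in nonnegative powers of w *)
Definition Yadd a : series2 n (V -> V) := fun s t b =>
  if t is inl k then hasse k (apply1 (Y a) b) s else 0.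

Definition Ysub a : series2 n (V -> V) := fun s t b =>
  if t is inl k then (-1) ^+ mdeg k *: hasse k (apply1 (Y a) b) s else 0.

(* Y(Y(a, z) b, -w) c *)
Definition YYneg a b c : series2 n V := fun s t =>
  negz N (apply1 (Y (vop a s b)) c) t.

Definition axiomV1 : Prop := forall a, cohomological_field (Y a).

Definition axiomV2 : Prop :=
  forall (s : sym n) b, Y (vac V) s b = if s == inl 0%MM then b else 0.

Definition axiomV3 : Prop :=
  forall a (s : sym n), Y a s (vac V) = expT s a.

Definition axiomV4 : Prop := forall a b (s t : sym n),
  mul2 N (op_inw expT) (mul2 N (op_inz (Y a)) (inw (expNT_at b))) s t
  = Yadd a s t b.

Definition axiomV5 : Prop := forall (p q : int) a b,
  has_degree p a -> has_degree q b -> mutually_local N p q (Y a) (Y b).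

Definition skew_symmetry : Prop := forall (p q : int) a b,
  has_degree p a -> has_degree q b ->
  forall s : sym n,
    Y a s b =
    ksign R (p * q) *: mul1 N expT (negz N (apply1 (Y b) a)) s.

Definition weak_associativity : Prop := forall a c,
  exists K : 'X_{1..n}, forall b,
    local_upto N K (fun s t =>
      mul2 N (Ysub a) (inw (negz N (apply1 (Y b) c))) s t - YYneg a b c s t).

End CVA.

(* Main.v *)
Require Import Defs.
From mathcomp Require Import all_boot all_order all_algebra.
From mathcomp Require Import boolp classical_sets fsbigop.
From mathcomp Require Import mpoly ring zify.

Set Implicit Arguments.
Unset Strict Implicit.
Unset Printing Implicit Defensive.

Import GRing.Theory.

Local Open Scope classical_set_scope.
Local Open Scope ring_scope.

(**
  The T^(j) assemble into e^{w.T}, and the whole argument takes place in the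
  algebra of power series theta(w) = sum_i w^i theta_i with theta_i in End V.
  Such a series acts on the V-valued series with finitely many nonzero
  Omega_w-coefficients (op_act), and composition of actions is multiplication
  of power series (op_act_mul).

  Given the vacuum axioms, translation covariance (V4) is equivalent to
    e^{w.T} e^{-w.T} = 1   and   e^{-w.T} Y(a, z) = Y(a, z - w) e^{-w.T}
  (axiomV4_translation); the first identity is the case a = |0> of (V4).

  The link between commutators and associators is defect_commutator. Applying
  skew-symmetry to Y(b, -w)c and to Y(Y(a, z)b, -w)c and moving e^{-w.T} to the
  left turns the weak associativity series into
    p(b, c) e^{-w.T} [Y(a, z), Y(c, w)] b.
  Multiplication by a power series in w with operator coefficients commutes
  with products by w^j and Omega_w^j, hence preserves locality with the same
  bound K (local_upto_op_act). As e^{-w.T} is invertible, (V5) and weak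
  associativity are therefore equivalent in the presence of translation and
  skew-symmetry.

  It remains to obtain the missing half of these prerequisites on each side.

  From (V4) and (V5) to skew-symmetry (skew_of_locality): on the vacuum, the
  residues Res_z (z - w)^j of [Y(a, z), Y(b, w)]|0> are e^{w.T} a_(j) b, and
  the terms of the local expansion with z^0 Omega_w^k are the singular part of
  skew-symmetry; its regular part is the vanishing of the terms z^0 w^k.

  From weak associativity to translation (translation_of_weak_assoc): for
  c = |0> the series is Y(a, z - w) e^{-w.T} b - e^{-w.T} Y(a, z) b, which has
  no Omega_w. A local series without Omega_w vanishes (local_no_Omega_w),
  which is the intertwining relation. Taking moreover b = |0> gives
  T^(k) T^(i) = binom(i + k, k) T^(i + k), whence e^{w.T} e^{-w.T} = 1.
*)

(** * Multi-indices below a bound *)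

Section Below.
Context (n : nat).
Implicit Types i j k m : 'X_{1..n}.

Definition below m : seq 'X_{1..n} :=
  map (@bmnm n _)
    (filter (fun j : 'X_{1..n < (mdeg m).+1} => j <= m)%MM (index_enum _)).

Lemma mdeg_le i m : (i <= m)%MM -> (mdeg i <= mdeg m)%N.
Proof. by move=> /submK <-; rewrite mdegD leq_addl. Qed.

Lemma mem_below i m : (i \in below m) = (i <= m)%MM.
Proof.
apply/mapP/idP => [[j]|le_im]; first by rewrite mem_filter => /andP[le_jm _] ->.
have hi : (mdeg i < (mdeg m).+1)%N by rewrite ltnS mdeg_le.
exists (BMultinom hi) => //=.
by rewrite mem_filter le_im mem_index_enum.
Qed.

Lemma below_uniq m : uniq (below m).
Proof.
rewrite map_inj_uniq; last exact: val_inj.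
by rewrite filter_uniq // index_enum_uniq.
Qed.

Lemma mnm_addBC i k : (i + k - i)%MM = k.
Proof. by apply/mnmP => x; rewrite mnmBE mnmDE addKn. Qed.

Lemma mnm_addK i k : (k + i - i)%MM = k.
Proof. by apply/mnmP => x; rewrite mnmBE mnmDE addnK. Qed.

Lemma mnm_lepD i k : (i <= i + k)%MM.
Proof. by apply/mnm_lepP => x; rewrite mnmDE leq_addr. Qed.

Lemma mnm_lepDr i k : (i <= k + i)%MM.
Proof. by apply/mnm_lepP => x; rewrite mnmDE leq_addl. Qed.

Lemma mnm_lep_add2l i j k : (i + j <= i + k)%MM = (j <= k)%MM.
Proof.
by apply/mnm_lepP/mnm_lepP => h x; move: (h x); rewrite !mnmDE leq_add2l.
Qed.

Lemma mnm_lepBR i j k : (i <= k)%MM -> (i + j <= k)%MM = (j <= k - i)%MM.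
Proof. by move=> /submK hk; rewrite -{1}hk [(_ + i)%MM]addmC mnm_lep_add2l. Qed.

End Below.

(** The r-th finite difference of the polynomial x |-> binom(x, j) is
    binom(x, j - r), by iterating Pascal's rule. *)
Lemma fin_diff_bin (R : pzRingType) (r x j : nat) :
  \sum_(i < r.+1) (-1) ^+ (r - i) * ('C(r, i) * 'C(x + i, j))%:R
  = (if (r <= j)%N then 'C(x, j - r)%:R else 0) :> R.
Proof.
elim: r x => [|r IH] x.
  by rewrite big_ord_recl big_ord0 expr0 mul1r bin0 mul1n addn0 subn0 addr0.
transitivity ((if (r <= j)%N then 'C(x.+1, j - r)%:R else 0)
              - (if (r <= j)%N then 'C(x, j - r)%:R else 0) : R); last first.
  case: (ltngtP r j) => [ltrj|gtrj|->]; rewrite ?subrr //.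
    by rewrite -(subnSK ltrj) binS natrD addrAC subrr add0r.
  by rewrite subnn !bin0 subrr.
rewrite -!IH.
rewrite big_ord_recl subn0 bin0 mul1n addn0.
under eq_bigr => i _ do
  rewrite lift0 subSS binS mulnDl natrD mulrDr.
rewrite big_split /= addrA [LHS]addrC; congr (_ + _).
  by apply: eq_bigr => i _; rewrite addSnnS.
rewrite [in LHS]big_ord_recr /= (bin_small (ltnSn r)) mul0n mulr0 addr0.
rewrite [in RHS]big_ord_recl subn0 bin0 mul1n addn0 opprD -sumrN.
congr (_ + _); first by rewrite exprS mulN1r mulNr.
apply: eq_bigr => i _; rewrite lift0.
have hi : (i.+1 <= r)%N by case: i.
by rewrite -(subnSK hi) exprS mulN1r mulNr.
Qed.
Section BelowSums.
Context (n : nat).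
Implicit Types i j k m : 'X_{1..n}.

(** The multi-indices below m form a box, so that sums of products of functions
    of one coordinate split. This reduces binomial identities for multi-indices
    to the case of one variable. *)
Lemma below_prod (R : comPzRingType) m (F : 'I_n -> nat -> R) :
  \sum_(i <- below m) \prod_(x < n) F x (i x)
  = \prod_(x < n) \sum_(y < (m x).+1) F x y.
Proof.
have le_mx x : (m x <= mdeg m)%N by rewrite mdegE (bigD1 x) //= leq_addr.
pose Q (x : 'I_n) (y : 'I_(mdeg m).+1) := (y < (m x).+1)%N.
transitivity (\prod_(x < n) \sum_(y | Q x y) F x (y : 'I_(mdeg m).+1)).
  rewrite bigA_distr_big_dep /=.
  pose g (f : {ffun 'I_n -> 'I_(mdeg m).+1}) : 'X_{1..n} :=
    [multinom (f x : nat) | x < n].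
  have g_inj : injective g.
    by move=> f f' /mnmP eq_f; apply/ffunP => x; apply: val_inj;
       have := eq_f x; rewrite !mnmE.
  rewrite -[RHS]big_filter.
  transitivity (\sum_(i <- map g [seq f <- index_enum _ | family Q f])
                 \prod_(x < n) F x (i x)); last first.
    by rewrite big_map; apply: eq_bigr => f _; apply: eq_bigr => x _;
       rewrite mnmE.
  apply/perm_big/uniq_perm => [||i]; first exact: below_uniq.
    by rewrite map_inj_uniq // filter_uniq // index_enum_uniq.
  rewrite mem_below; apply/mnm_lepP/mapP => [le_im|[f]].
    have lt_ix x : (i x < (mdeg m).+1)%N.
      by rewrite ltnS (leq_trans (le_im x)).
    exists [ffun x => Ordinal (lt_ix x)].
      rewrite mem_filter mem_index_enum andbT; apply/familyP => x.
      by rewrite ffunE unfold_in /Q /= ltnS.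
    by apply/mnmP => x; rewrite mnmE ffunE.
  rewrite mem_filter => /andP[/familyP hf _] -> x; rewrite mnmE.
  by have := hf x; rewrite unfold_in /Q ltnS.
apply: eq_bigr => x _.
have hx : ((m x).+1 <= (mdeg m).+1)%N by rewrite ltnS.
by rewrite (big_ord_widen _ (F x) hx).
Qed.

Lemma mbin_small i j : ~~ (j <= i)%MM -> mbin i j = 0%N.
Proof.
move=> /mnm_lepP/existsNP[x /negP]; rewrite -ltnNge => /bin_small hx.
by rewrite /mbin (bigD1 x) //= hx mul0n.
Qed.

Lemma mbinn i : mbin i i = 1%N.
Proof. by rewrite /mbin big1 // => x _; rewrite binn. Qed.

Lemma mbin0 i : mbin i 0%MM = 1%N.
Proof. by rewrite /mbin big1 // => x _; rewrite mnm0E bin0. Qed.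

Lemma mbin_sub i j : (j <= i)%MM -> mbin i (i - j)%MM = mbin i j.
Proof.
move=> /mnm_lepP le_ji; apply: eq_bigr => x _.
by rewrite mnmBE bin_sub.
Qed.

(** The only binomial identity of the proof. With x = 0 it is the orthogonality
    of the signed binomial matrix and the binomial matrix. *)
Lemma fin_diff_mbin (R : comPzRingType) (r x j : 'X_{1..n}) :
  \sum_(i <- below r) (-1) ^+ mdeg (r - i)%MM * (mbin r i * mbin (x + i)%MM j)%N%:R
  = (if (r <= j)%MM then (mbin x (j - r)%MM)%:R else 0) :> R.
Proof.
transitivity (\sum_(i <- below r) \prod_(y < n)
   ((-1) ^+ (r y - i y) * ('C(r y, i y) * 'C(x y + i y, j y))%:R) : R).
  apply: eq_bigr => i _; rewrite big_split /= mdegE -prodrXr.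
  congr (_ * _); first by apply: eq_bigr => y _; rewrite mnmBE.
  rewrite /mbin -big_split natr_prod; apply: eq_bigr => y _.
  by rewrite mnmDE.
rewrite (below_prod r (fun y (i : nat) =>
   (-1) ^+ (r y - i) * ('C(r y, i) * 'C(x y + i, j y))%:R)).
under eq_bigr => y _ do rewrite fin_diff_bin.
case: mnm_lepP => [le_rj|/existsNP[y /negP/negbTE hy]].
  rewrite /mbin natr_prod; apply: eq_bigr => y _.
  by rewrite le_rj mnmBE.
by rewrite (bigD1 y) //= hy mul0r.
Qed.

Section Reindex.
Context (M : nmodType).

Lemma below_rev m (F : 'X_{1..n} -> M) :
  \sum_(i <- below m) F (m - i)%MM = \sum_(i <- below m) F i.
Proof.
rewrite -(big_map (fun i => m - i)%MM xpredT); apply/perm_big/uniq_perm.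
- rewrite map_inj_in_uniq ?below_uniq // => i j; rewrite !mem_below.
  move=> /mnm_lepP le_im /mnm_lepP le_jm /mnmP eq_ij; apply/mnmP => x.
  by have := eq_ij x; rewrite !mnmBE => h; rewrite -(subKn (le_im x)) h subKn.
- exact: below_uniq.
move=> i; rewrite mem_below; apply/mapP/idP => [[j _ ->]|le_im].
  by apply/mnm_lepP => x; rewrite mnmBE leq_subr.
exists (m - i)%MM; first by
  rewrite mem_below; apply/mnm_lepP => x; rewrite mnmBE leq_subr.
by apply/mnmP => x; rewrite !mnmBE subKn // (mnm_lepP le_im).
Qed.

Lemma below_widen m m' (F : 'X_{1..n} -> M) : (m <= m')%MM ->
  \sum_(i <- below m' | (i <= m)%MM) F i = \sum_(i <- below m) F i.
Proof.
move=> le_mm'; rewrite -big_filter; apply/perm_big/uniq_perm.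
- by rewrite filter_uniq // below_uniq.
- exact: below_uniq.
move=> i; rewrite mem_filter !mem_below andb_idr // => le_im.
exact: lepm_trans le_mm'.
Qed.

Lemma below_shift B i (F : 'X_{1..n} -> M) :
  (forall j, ~~ (i + j <= B)%MM -> F j = 0) ->
  \sum_(j <- below B) F j
  = \sum_(m <- below B | (i <= m)%MM) F (m - i)%MM.
Proof.
move=> F0; rewrite (bigID (fun j => i + j <= B)%MM) /= [X in _ + X]big1 ?addr0;
  last by move=> j; apply: F0.
rewrite -big_filter -[RHS]big_filter.
rewrite -[RHS](big_map (fun m => m - i)%MM xpredT); apply/perm_big/uniq_perm.
- by rewrite filter_uniq // below_uniq.
- rewrite map_inj_in_uniq ?filter_uniq ?below_uniq // => j k.
  rewrite !mem_filter => /andP[/submK hj _] /andP[/submK hk _] eq_jk.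
  by rewrite -hj -hk eq_jk.
move=> j; rewrite mem_filter mem_below; apply/andP/mapP => [[le_ijB le_jB]|].
  exists (i + j)%MM; last by rewrite mnm_addBC.
  by rewrite mem_filter mem_below le_ijB mnm_lepD.
move=> [k]; rewrite mem_filter mem_below => /andP[le_ik le_kB] ->.
rewrite addmC submK //; split => //.
by apply: lepm_trans le_kB; apply/mnm_lepP => x; rewrite mnmBE leq_subr.
Qed.

(** The Cauchy product, for a doubly indexed family with support in the simplex
    i + j <= B. *)
Lemma below_triangle B (G : 'X_{1..n} -> 'X_{1..n} -> M) :
  (forall i j, ~~ (i + j <= B)%MM -> G i j = 0) ->
  \sum_(i <- below B) \sum_(j <- below B) G i j
  = \sum_(m <- below B) \sum_(i <- below m) G i (m - i)%MM.
Proof.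
move=> G0.
under eq_bigr => i _ do rewrite (below_shift (G0 i)) big_mkcond.
rewrite exchange_big [LHS]big_seq [RHS]big_seq.
apply: eq_bigr => m; rewrite mem_below => le_mB.
by rewrite -big_mkcond below_widen.
Qed.

End Reindex.
End BelowSums.

(** * Finitely supported sums *)

Section FiniteSupport.
Context (M : nmodType) (I : choiceType).

Lemma fsum_seq (r : seq I) (F : I -> M) : uniq r ->
  (forall i, i \notin r -> F i = 0) ->
  \sum_(i \in [set: I]) F i = \sum_(i <- r) F i.
Proof.
move=> r_uniq F0; rewrite (fsbigE r F r_uniq) // => [|i _]; last exact: F0.
by apply: eq_bigl => i; rewrite in_setT.
Qed.

Lemma fsum_single (i0 : I) (F : I -> M) :
  (forall i, i != i0 -> F i = 0) -> \sum_(i \in [set: I]) F i = F i0.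
Proof.
move=> F0; rewrite (fsum_seq (r := [:: i0])) ?big_seq1 // => i.
by rewrite inE => /F0.
Qed.

Lemma fsum_map (J : eqType) (g : J -> I) (r : seq J) (F : I -> M) :
  injective g -> uniq r -> (forall i, i \notin map g r -> F i = 0) ->
  \sum_(i \in [set: I]) F i = \sum_(j <- r) F (g j).
Proof.
move=> g_inj r_uniq F0; rewrite (fsum_seq (r := map g r)) ?big_map //.
by rewrite map_inj_uniq.
Qed.

Lemma fsum_eq (F G : I -> M) : F =1 G ->
  \sum_(i \in [set: I]) F i = \sum_(i \in [set: I]) G i.
Proof. by move=> /funext ->. Qed.

Lemma fsum0 : \sum_(i \in [set: I]) (0 : M) = 0.
Proof. by rewrite fsbig1. Qed.

End FiniteSupport.

Lemma fsum_inj (M : nmodType) (I J : choiceType) (g : J -> I) (F : I -> M) :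
  injective g -> (forall i, (forall j, i <> g j) -> F i = 0) ->
  \sum_(i \in [set: I]) F i = \sum_(j \in [set: J]) F (g j).
Proof.
move=> g_inj F0; rewrite -(fsbig_image _ g); last by move=> ? ? _ _ /g_inj.
apply/esym/fsbig_widen => // i [_ not_im]; apply: F0 => j eq_i.
by apply: not_im; exists j.
Qed.

(** * Linear maps given as plain functions *)

Section Linear.
Context (R : pzRingType) (U V : lmodType R) (f : U -> V) (f_lin : linear f).

Lemma linD u v : f (u + v) = f u + f v.
Proof. by rewrite -[in LHS](scale1r u) f_lin scale1r. Qed.

Lemma lin0 : f 0 = 0.
Proof. by apply: (addIr (f 0)); rewrite -linD !add0r. Qed.

Lemma linZ c u : f (c *: u) = c *: f u.
Proof. by rewrite -[in LHS](addr0 (c *: u)) f_lin lin0 addr0. Qed.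

Lemma lin_sum (I : Type) (r : seq I) (P : pred I) (F : I -> U) :
  f (\sum_(i <- r | P i) F i) = \sum_(i <- r | P i) f (F i).
Proof. exact: (big_morph f linD lin0). Qed.

End Linear.

(** * Multiplication by a symbol *)

Section Symbols.
Context (R : comPzRingType) (n : nat) (M : lmodType R).
Implicit Types (i j k m : 'X_{1..n}) (s t u v : sym n) (F G : series1 n M).

Definition symdeg t : 'X_{1..n} := match t with inl m | inr m => m end.

(** Multiplication by a symbol only moves coefficients: the coefficient of t in
    u F is the coefficient of mulsym_src u t in F, or 0. *)
Definition mulsym_src u t : option (sym n) :=
  match u, t with
  | inl j, inl k => if (j <= k)%MM then Some (inl (k - j)%MM) else None
  | inl j, inr k => Some (inr (k + j)%MM)
  | inr j, inr k => if (k <= j)%MM then Some (inl (j - k)%MM) else None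
  | inr _, inl _ => None
  end.

Lemma mulsymE u F t : mulsym u F t = oapp F 0 (mulsym_src u t).
Proof. by case: u t => j [k|k] //=; case: ifP. Qed.

Lemma mulsym_comp (f : M -> M) u F t : f 0 = 0 ->
  mulsym u (fun t' => f (F t')) t = f (mulsym u F t).
Proof. by move=> f0; rewrite !mulsymE; case: mulsym_src. Qed.

Lemma mulsym_sum (I : Type) (r : seq I) (F : I -> series1 n M) u t :
  mulsym u (fun t' => \sum_(i <- r) F i t') t = \sum_(i <- r) mulsym u (F i) t.
Proof.
rewrite mulsymE; under [RHS]eq_bigr do rewrite mulsymE.
by case: mulsym_src => //=; rewrite big1.
Qed.

Lemma mulsym_fsum (I : choiceType) (F : I -> series1 n M) u t :
  mulsym u (fun t' => \sum_(i \in [set: I]) F i t') t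
  = \sum_(i \in [set: I]) mulsym u (F i) t.
Proof.
rewrite mulsymE; under [RHS]fsum_eq => i do rewrite mulsymE.
by case: mulsym_src => //=; rewrite fsum0.
Qed.

Lemma mulsymD u F G t :
  mulsym u (fun t' => F t' + G t') t = mulsym u F t + mulsym u G t.
Proof. by rewrite !mulsymE; case: mulsym_src => //=; rewrite addr0. Qed.

Lemma mulsymZ u (c : R) F t :
  mulsym u (fun t' => c *: F t') t = c *: mulsym u F t.
Proof. by rewrite mulsym_comp ?scaler0. Qed.

Lemma mulsym_eq0 u F t : (forall t', F t' = 0) -> mulsym u F t = 0.
Proof. by move=> F0; rewrite mulsymE; case: mulsym_src => //=. Qed.

Lemma mulsym_id F : mulsym (inl 0%MM) F = F.
Proof.
apply/funext => -[k|k] /=; last by rewrite addm0.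
have -> : (0 <= k)%MM by apply/mnm_lepP => x; rewrite mnm0E.
by rewrite subm0.
Qed.

Lemma mulsym_zz i j F :
  mulsym (inl i) (mulsym (inl j) F) = mulsym (inl (i + j)%MM) F.
Proof.
apply/funext => -[k|k] /=; last by rewrite addmA.
rewrite submDA; have [le_ik|le_ikF] := boolP (i <= k)%MM.
  by rewrite mnm_lepBR.
case: ifP => // le_ijk; case/negP: le_ikF.
exact: lepm_trans (mnm_lepD _ _) le_ijk.
Qed.

Lemma mulsymC i u F :
  mulsym (inl i) (mulsym u F) = mulsym u (mulsym (inl i) F).
Proof.
case: u => j; first by rewrite !mulsym_zz addmC.
apply/funext => -[k|k] /=; first by rewrite if_same.
rewrite submDA; have [le_kj|le_kjF] := boolP (k <= j)%MM.
  by rewrite mnm_lepBR.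
case: ifP => // le_kij; case/negP: le_kjF.
exact: lepm_trans (mnm_lepD _ _) le_kij.
Qed.

Lemma mulsym_const u F t : (forall s, s != inl 0%MM -> F s = 0) ->
  mulsym u F t = if u == t then F (inl 0%MM) else 0.
Proof.
move=> F0; case: u t => j [k|k] /=.
- have [/(congr1 symdeg) /= ->|neq_jk] := eqVneq (inl j : sym n) (inl k).
    rewrite lepm_refl; congr F; congr inl; apply/mnmP => x.
    by rewrite mnmBE mnm0E subnn.
  case: ifP => // /submK le_jk; apply: F0; apply: contraNneq neq_jk.
  by move=> /(congr1 symdeg) /= eq0; rewrite -le_jk eq0 add0m.
- by rewrite F0.
- by [].
- have [/(congr1 symdeg) /= ->|neq_jk] := eqVneq (inr j : sym n) (inr k).
    rewrite lepm_refl; congr F; congr inl; apply/mnmP => x.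
    by rewrite mnmBE mnm0E subnn.
  case: ifP => // /submK le_jk; apply: F0; apply: contraNneq neq_jk.
  by move=> /(congr1 symdeg) /= eq0; rewrite -le_jk eq0 add0m.
Qed.

Lemma eq_mulsym_parity i F G t :
  (forall t', isOmega t' = isOmega t -> F t' = G t') ->
  mulsym (inl i) F t = mulsym (inl i) G t.
Proof.
by move=> eqFG; case: t eqFG => k eqFG /=; [case: ifP => // _|]; apply: eqFG.
Qed.

End Symbols.

(** * Power series of operators acting on series *)

Section OperatorSeries.
Context (R : comPzRingType) (n : nat) (M : lmodType R).
Implicit Types (i j k m : 'X_{1..n}) (s t u : sym n) (v : M).
Implicit Types (F G : series1 n M) (th et : 'X_{1..n} -> M -> M).

(** theta(w) F(w) for theta(w) = sum_i w^i theta_i, without Koszul signs: the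
    powers of w have degree 0. *)
Definition op_act th F : series1 n M := fun t =>
  \sum_(i \in [set: 'X_{1..n}]) mulsym (inl i) (fun t' => th i (F t')) t.

(** The coefficient of w^m in theta(w) eta(w). *)
Definition op_mul th et m (v : M) : M := \sum_(i <- below m) th i (et (m - i)%MM v).

Definition bounded (K : 'X_{1..n}) F : Prop :=
  forall k, ~~ (k <= K)%MM -> F (inr k) = 0.

Lemma boundedW K K' F : (K <= K')%MM -> bounded K F -> bounded K' F.
Proof.
move=> le_KK' FK k leF; apply: FK; apply: contra leF => le_kK.
exact: lepm_trans le_KK'.
Qed.

Lemma bounded2 F G : lower_bounded F -> lower_bounded G ->
  exists K, bounded K F /\ bounded K G.
Proof.
move=> [K FK] [L GL]; exists (K + L)%MM.
by split; [apply: boundedW FK; apply: mnm_lepD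
          |apply: boundedW GL; apply: mnm_lepDr].
Qed.

Lemma lower_boundedD F G : lower_bounded F -> lower_bounded G ->
  lower_bounded (fun t => F t + G t).
Proof.
move=> hF hG; have [K [FK GK]] := bounded2 hF hG.
by exists K => k hk; rewrite FK // GK // addr0.
Qed.

Lemma lower_bounded_comp (f : M -> M) F : f 0 = 0 -> lower_bounded F ->
  lower_bounded (fun t => f (F t)).
Proof. by move=> f0 [K FK]; exists K => k hk; rewrite FK. Qed.

Lemma lower_bounded_sum (I : Type) (r : seq I) (F : I -> series1 n M) :
  (forall x, lower_bounded (F x)) ->
  lower_bounded (fun t => \sum_(x <- r) F x t).
Proof.
move=> hF; elim: r => [|x r IH].
  by exists 0%MM => k _; rewrite big_nil.
have [K hK] := lower_boundedD (hF x) IH.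
by exists K => k hk; rewrite big_cons hK.
Qed.

Lemma lower_bounded_mulsym u F : lower_bounded F ->
  lower_bounded (mulsym u F).
Proof.
move=> [K FK]; case: u => j.
  exists K => k hk /=; apply: FK; apply: contra hk.
  exact: lepm_trans (mnm_lepD _ _).
by exists j => k /negbTE hk /=; rewrite hk.
Qed.

(** The powers w^i with i outside of the box B do not contribute to the
    coefficient of t in theta(w) F(w). *)
Definition reaches (B : 'X_{1..n}) F t : Prop :=
  match t with
  | inl m => (m <= B)%MM
  | inr m => forall i, ~~ (i <= B)%MM -> F (inr (m + i)%MM) = 0
  end.

Lemma bounded_reaches K F t : bounded K F -> reaches (K + symdeg t)%MM F t.
Proof.
case: t => m FK /=; first exact: mnm_lepDr.
move=> i hi; apply: FK; apply: contra hi => le_miK.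
apply: lepm_trans (mnm_lepDr _ _) (lepm_trans le_miK _); exact: mnm_lepD.
Qed.

Lemma reaches_mulsym B (f : M -> M) i F t : f 0 = 0 -> reaches B F t ->
  ~~ (i <= B)%MM -> mulsym (inl i) (fun t' => f (F t')) t = 0.
Proof.
move=> f0; case: t => m /= hB hi; last by rewrite hB.
case: ifP => // le_im; case/negP: hi; exact: lepm_trans hB.
Qed.

Lemma op_actE B th F t : (forall i, th i 0 = 0) -> reaches B F t ->
  op_act th F t = \sum_(i <- below B) mulsym (inl i) (fun t' => th i (F t')) t.
Proof.
move=> th0 hB; apply: fsum_seq; first exact: below_uniq.
by move=> i; rewrite mem_below; apply: reaches_mulsym.
Qed.

Lemma op_act_zE th F m : (forall i, th i 0 = 0) ->
  op_act th F (inl m) = \sum_(i <- below m) th i (F (inl (m - i)%MM)).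
Proof.
move=> th0; rewrite (op_actE (B := m)) //=; last exact: lepm_refl.
rewrite !big_seq; apply: eq_bigr => i; rewrite mem_below => le_im.
by rewrite le_im.
Qed.

Lemma op_act_OmegaE K th F m : (forall i, th i 0 = 0) -> bounded K F ->
  op_act th F (inr m) = \sum_(i <- below K) th i (F (inr (m + i)%MM)).
Proof.
move=> th0 FK; rewrite (op_actE (B := K)) //= => i hi; apply: FK.
by apply: contra hi; apply: lepm_trans (mnm_lepDr _ _).
Qed.

Lemma op_act_mulsym th u F : (forall i, th i 0 = 0) ->
  op_act th (mulsym u F) = mulsym u (op_act th F).
Proof.
move=> th0; apply/funext => t; rewrite /op_act mulsym_fsum; apply: fsum_eq => i.
rewrite -mulsymC; congr (mulsym _ _ t); apply/funext => t'.
by rewrite mulsym_comp.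
Qed.

Lemma op_act_bounded th K F : (forall i, th i 0 = 0) -> bounded K F ->
  bounded K (op_act th F).
Proof.
move=> th0 FK k hk; rewrite /op_act fsbig1 // => i _ /=.
rewrite FK //; apply: contra hk; exact: lepm_trans (mnm_lepD _ _).
Qed.

Lemma op_act_lower_bounded th F : (forall i, th i 0 = 0) ->
  lower_bounded F -> lower_bounded (op_act th F).
Proof. by move=> th0 [K FK]; exists K; exact: op_act_bounded. Qed.

Section LinearFamily.
Context (th : 'X_{1..n} -> M -> M) (th_lin : forall i, linear (th i)).
Let th0 i : th i 0 = 0. Proof. exact: lin0. Qed.

Lemma op_actD F G : lower_bounded F -> lower_bounded G ->
  op_act th (fun t => F t + G t) = fun t => op_act th F t + op_act th G t.
Proof.
move=> hF hG; have [K [FK GK]] := bounded2 hF hG; apply/funext => t.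
rewrite !(op_actE th0 (bounded_reaches t FK)) (op_actE th0 (bounded_reaches t GK)).
rewrite (op_actE (B := (K + symdeg t)%MM)) //; last first.
  apply: bounded_reaches => k hk; by rewrite FK // GK // addr0.
rewrite -big_split; apply: eq_bigr => i _; rewrite -[RHS]mulsymD.
by congr (mulsym _ _ t); apply/funext => t'; rewrite linD.
Qed.

Lemma op_actZ (c : R) F : lower_bounded F ->
  op_act th (fun t => c *: F t) = fun t => c *: op_act th F t.
Proof.
move=> [K FK]; apply/funext => t.
rewrite !(op_actE th0 (bounded_reaches t FK)) (op_actE (B := (K + symdeg t)%MM)) //.
  rewrite scaler_sumr; apply: eq_bigr => i _; rewrite -[RHS]mulsymZ.
  by congr (mulsym _ _ t); apply/funext => t'; rewrite linZ.
by apply: bounded_reaches => k hk; rewrite FK // scaler0.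
Qed.

Lemma op_act_sum (I : Type) (r : seq I) (F : I -> series1 n M) :
  (forall x, lower_bounded (F x)) ->
  op_act th (fun t => \sum_(x <- r) F x t)
  = fun t => \sum_(x <- r) op_act th (F x) t.
Proof.
move=> hF; elim: r => [|x r IH]; apply/funext => t.
  rewrite big_nil /op_act fsbig1 // => i _; apply: mulsym_eq0 => t'.
  by rewrite big_nil.
rewrite big_cons -(congr1 (fun h => h t) IH) -[RHS](congr1 (fun h => h t)
  (op_actD (hF x) (lower_bounded_sum r hF))).
by congr (op_act th _ t); apply/funext => t'; rewrite big_cons.
Qed.

Lemma op_act_mul et F : (forall i, linear (et i)) -> lower_bounded F ->
  op_act th (op_act et F) = op_act (op_mul th et) F.
Proof.
move=> et_lin [K FK]; apply/funext => t.
have et0 i : et i 0 = 0 by exact: lin0.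
pose B := (K + symdeg t)%MM.
have FB : bounded B F by apply: boundedW FK; apply: mnm_lepD.
rewrite (op_actE th0 (bounded_reaches t (op_act_bounded et0 FK))) -/B.
rewrite (op_actE (B := B)) ?bounded_reaches //; first last.
- exact: bounded_reaches.
- by move=> i; rewrite /op_mul big1 // => j _; rewrite et0 th0.
have inner i : mulsym (inl i) (fun t' => th i (op_act et F t')) t
  = \sum_(j <- below B) mulsym (inl (i + j)%MM)
      (fun t' => th i (et j (F t'))) t.
  transitivity (mulsym (inl i) (fun t' => \sum_(j <- below B)
      mulsym (inl j) (fun t'' => th i (et j (F t''))) t') t).
    rewrite !mulsymE; case E : mulsym_src => [t'|] //.
    change (th i (op_act et F t') = \sum_(j <- below B)
      mulsym (inl j) (fun t'' => th i (et j (F t''))) t').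
    rewrite (op_actE (B := B)) //; first last.
      case: t' E => k E /=; last first.
        move=> j hj; apply: FB; apply: contra hj.
        exact: lepm_trans (mnm_lepDr _ _).
      have le_tB : (symdeg t <= B)%MM by apply: mnm_lepDr.
      apply: lepm_trans le_tB; case: t @B FB E => [m|m] B _ //=.
      by case: ifP => // _ [<-]; apply/mnm_lepP => x; rewrite mnmBE leq_subr.
    rewrite lin_sum //; apply: eq_bigr => j _.
    by rewrite (mulsym_comp (f := th i)).
  by rewrite mulsym_sum; apply: eq_bigr => j _; rewrite mulsym_zz.
under eq_bigr => i _ do rewrite inner.
rewrite below_triangle; last first.
  move=> i j; apply: (reaches_mulsym (f := fun v => th i (et j v))).
    by rewrite et0 th0.
  exact: bounded_reaches.
apply: eq_bigr => m _.
rewrite /op_mul mulsym_sum [LHS]big_seq [RHS]big_seq.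
apply: eq_bigr => i; rewrite mem_below => le_im.
by rewrite addmC submK.
Qed.

End LinearFamily.

Lemma op_mul_lin th et : (forall i, linear (th i)) -> (forall i, linear (et i)) ->
  forall m, linear (op_mul th et m).
Proof.
move=> th_lin et_lin m c u v; rewrite /op_mul scaler_sumr -big_split.
by apply: eq_bigr => i _; rewrite et_lin th_lin.
Qed.

(** theta(w) v. Families of operators thus become special series, and the algebra
    of operator power series inherits its laws from its action on series. *)
Definition zseries th (v : M) : series1 n M :=
  fun t => if t is inl m then th m v else 0.

Lemma zseries_bounded th v : lower_bounded (zseries th v).
Proof. by exists 0%MM. Qed.

Lemma op_act_zseries th et v : (forall i, th i 0 = 0) ->
  op_act th (zseries et v) = zseries (op_mul th et) v.
Proof.
move=> th0; apply/funext => -[m|m]; first by rewrite op_act_zE.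
by rewrite /op_act fsbig1 // => i _ /=.
Qed.

Lemma op_mulA th et ze : (forall i, linear (th i)) ->
  (forall i, linear (et i)) -> (forall i, linear (ze i)) ->
  op_mul th (op_mul et ze) = op_mul (op_mul th et) ze.
Proof.
move=> th_lin et_lin ze_lin; apply/funext => m; apply/funext => v.
have th0 i : th i 0 = 0 by exact: lin0.
have et0 i : et i 0 = 0 by exact: lin0.
have te0 i : op_mul th et i 0 = 0 by apply/lin0/op_mul_lin.
have := op_act_mul th_lin et_lin (zseries_bounded ze v).
by rewrite !op_act_zseries // => /(congr1 (fun h => h (inl m))).
Qed.

(** theta(-w) *)
Definition op_neg th i (v : M) : M := (-1) ^+ mdeg i *: th i v.

(** The constant power series f. *)
Definition op_const (f : M -> M) i (v : M) : M := if i == 0%MM then f v else 0.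

Lemma op_neg_lin th : (forall i, linear (th i)) -> forall i, linear (op_neg th i).
Proof.
move=> th_lin i c u v; rewrite /op_neg th_lin scalerDr !scalerA.
by rewrite [in (-1) ^+ _ * c]mulrC.
Qed.

Lemma op_const_lin f : linear f -> forall i, linear (op_const f i).
Proof.
move=> f_lin i c u v; rewrite /op_const; case: eqP => _; first exact: f_lin.
by rewrite scaler0 addr0.
Qed.

Lemma op_neg_mul th et : (forall i, linear (th i)) ->
  op_neg (op_mul th et) = op_mul (op_neg th) (op_neg et).
Proof.
move=> th_lin; apply/funext => m; apply/funext => v.
rewrite /op_neg /op_mul scaler_sumr !big_seq; apply: eq_bigr => i.
rewrite mem_below => /submK le_im; rewrite (linZ (th_lin _)) scalerA -exprD.
by rewrite -mdegD addmC le_im.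
Qed.

Lemma op_mul_const_l f et : op_mul (op_const f) et = fun m v => f (et m v).
Proof.
apply/funext => m; apply/funext => v.
rewrite /op_mul (bigD1_seq 0%MM) ?below_uniq //=; last first.
  by rewrite mem_below; apply/mnm_lepP => x; rewrite mnm0E.
rewrite subm0 {1}/op_const eqxx big1 ?addr0 // => i /negbTE hi.
by rewrite /op_const hi.
Qed.

Lemma op_mul_const_r th f : (forall i, linear (th i)) ->
  op_mul th (op_const f) = fun m v => th m (f v).
Proof.
move=> th_lin; apply/funext => m; apply/funext => v; rewrite /op_mul -below_rev.
rewrite (bigD1_seq 0%MM) ?below_uniq //=; last first.
  by rewrite mem_below; apply/mnm_lepP => x; rewrite mnm0E.
have mm : (m - m = 0)%MM by apply/mnmP => x; rewrite mnmBE mnm0E subnn.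
rewrite subm0 mm {1}/op_const eqxx big1_seq ?addr0 // => i /andP[nz_i].
rewrite mem_below => /submK le_im; rewrite /op_const.
have -> : (m - (m - i))%MM = i.
  by rewrite -{1}le_im addmC mnm_addK.
by rewrite (negbTE nz_i) (lin0 (th_lin _)).
Qed.

Lemma op_act_const f F : f 0 = 0 -> op_act (op_const f) F = fun t => f (F t).
Proof.
move=> f0; apply/funext => t; rewrite /op_act (fsum_single (i0 := 0%MM)).
  by rewrite mulsym_id /op_const eqxx.
by move=> i /negbTE hi; apply: mulsym_eq0 => t'; rewrite /op_const hi.
Qed.

End OperatorSeries.

(** * Signs *)

Section Signs.
Context (R : comPzRingType).
Implicit Types d e : int.

Lemma odd_abszD d e : odd (absz (d + e)) = odd (absz d) (+) odd (absz e).
Proof. lia. Qed.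

Lemma odd_abszM d e : odd (absz (d * e)) = odd (absz d) && odd (absz e).
Proof. by rewrite abszM oddM. Qed.

Lemma ksignD d e : ksign R (d + e) = ksign R d * ksign R e.
Proof.
by rewrite /ksign -signr_odd odd_abszD signr_addb !signr_odd.
Qed.

Lemma ksign_sqr d : ksign R d * ksign R d = 1.
Proof. by rewrite /ksign -expr2 sqrr_sign. Qed.

Lemma eq_ksign d e : odd (absz d) = odd (absz e) -> ksign R d = ksign R e.
Proof. by move=> eq_de; rewrite /ksign -signr_odd eq_de signr_odd. Qed.

Lemma ksignK (M : lmodType R) d (v : M) : ksign R d *: (ksign R d *: v) = v.
Proof. by rewrite scalerA ksign_sqr scale1r. Qed.

Lemma signK (M : lmodType R) k (v : M) : (-1 : R) ^+ k *: ((-1) ^+ k *: v) = v.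
Proof. by rewrite scalerA -expr2 sqrr_sign scale1r. Qed.

End Signs.

(** * Locality *)

Section Locality.
Context (R : comPzRingType) (n : nat) (N : int) (M : lmodType R).
Implicit Types (i j k l m K : 'X_{1..n}) (s t u v : sym n).
Implicit Types (F G g : series1 n M) (f : series2 n M).

Lemma mulmon_const (f : series2 n M) u v s t :
  (forall s' t', s' != inl 0%MM -> f s' t' = 0) ->
  mulmon N u v f s t = if u == s then mulsym v (f (inl 0%MM)) t else 0.
Proof.
move=> f0; rewrite /mulmon mulsym_const => [|s' hs']; last first.
  by apply: mulsym_eq0 => t'; rewrite f0 // scaler0.
case: ifP => // _; congr (mulsym _ _ t).
by apply/funext => t'; rewrite andbF scale1r.
Qed.

(** The w-part of the term of s_z in the j-th Hasse derivative of Delta is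
    loc_coef j s times the symbol loc_sym j s. In loc_sym the truncated
    difference i - j may be wrong, but then the binomial coefficient is 0. *)
Definition loc_coef j s : R :=
  match s with
  | inr i => (mbin i j)%:R
  | inl i => (-1) ^+ mdeg j * ksign R N * (mbin (i + j)%MM j)%:R
  end.

Definition loc_sym j s : sym n :=
  match s with
  | inr i => inl (i - j)%MM
  | inl i => inr (i + j)%MM
  end.

Lemma hasse_DeltaE j s t :
  hasse_Delta R N j s t = if t == loc_sym j s then loc_coef j s else 0.
Proof.
case: s t => i [k|k]; rewrite /hasse_Delta /=.
- by rewrite mul0rn.
- case: ifP => [le_jk|nle_jk]; last first.
    by case: eqP => // -[] /(congr1 (fun m => j <= m)%MM); rewrite nle_jk mnm_lepDr.
  have -> : (inr k == inr (i + j)%MM :> sym n) = (i == k - j)%MM.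
    apply/eqP/eqP => [/(congr1 (@symdeg _)) /= ->|->]; first by rewrite mnm_addK.
    by rewrite submK.
  case: eqP => [->|_]; last by rewrite mulr0 mul0rn scaler0.
  by rewrite submK // mulr1 mulr_natr; exact: mulrnAr.
- have -> : (inl k == inl (i - j)%MM :> sym n) = (k == i - j)%MM.
    by apply/eqP/eqP => [/(congr1 (@symdeg _))|->].
  have [->|neq] := eqVneq k (i - j)%MM.
    have [le_ji|nle_ji] := boolP (j <= i)%MM.
      by rewrite submK // eqxx -mulr_natr mul1r.
    rewrite (mbin_small nle_ji); case: eqP => [eq_i|_]; last by rewrite mul0rn.
    by case/negP: nle_ji; rewrite eq_i mnm_lepDr.
  case: eqP => [eq_i|]; last by rewrite mul0rn.
  by rewrite eq_i mnm_addK eqxx in neq.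
- by rewrite mul0rn scaler0 if_same.
Qed.

Lemma scale2_hasse_Delta j g s t :
  scale2 N (hasse_Delta R N j) (inw g) s t
  = loc_coef j s *: mulsym (loc_sym j s) g t.
Proof.
rewrite /scale2 (fsum_single (i0 := (s, loc_sym j s))) /=.
  rewrite mulmon_const; last first.
    by move=> s' t' /negbTE hs'; rewrite /inw hs' scaler0.
  rewrite eqxx -mulsymZ hasse_DeltaE eqxx; congr (mulsym _ _ t).
  by apply/funext => t'; rewrite /inw eqxx.
move=> [u1 u2] neq_u /=; rewrite mulmon_const; last first.
  by move=> s' t' /negbTE hs'; rewrite /inw hs' scaler0.
case: eqP => // eq_u1; apply: mulsym_eq0 => t'; rewrite hasse_DeltaE.
case: eqP => [eq_u2|]; last by rewrite scale0r.
by rewrite eq_u1 in eq_u2 neq_u; rewrite eq_u2 eqxx in neq_u.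
Qed.

(** Res_z ((z - w)^j f) *)
Definition res_coef f j : series1 n M := fun t =>
  \sum_(i <- below j)
    ((-1) ^+ mdeg (j - i)%MM *+ mbin j i) *: mulsym (inl (j - i)%MM) (f (inr i)) t.

Lemma Res_subX j f : Res (scale2 N (subX R j) f) = res_coef f j.
Proof.
apply/funext => t; rewrite /Res /scale2.
pose g i : sym n * sym n := (inl i, inl (j - i)%MM).
rewrite (fsum_map (g := g) (r := below j)).
- rewrite /res_coef [LHS]big_seq [RHS]big_seq; apply: eq_bigr => i.
  rewrite mem_below => le_ij; rewrite -mulsymZ.
  rewrite -[LHS]/(mulsym (inl (j - i)%MM) (fun t' => 1 *:
    (subX R j (inl i) (inl (j - i)%MM) *: f (inr (0 + i)%MM) t')) t).
  rewrite add0m; congr (mulsym _ _ t); apply/funext => t'.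
  by rewrite scale1r /= addmC submK // eqxx.
- by move=> i k /(congr1 (fun x => symdeg x.1)).
- exact: below_uniq.
move=> [[i|i] [k|k]] neq_u; rewrite /mulmon;
  apply: mulsym_eq0 => s'; apply: mulsym_eq0 => t';
  rewrite /= ?scale0r ?scaler0 //.
case: eqP => [eq_j|]; last by rewrite scale0r scaler0.
case/negP: neq_u; apply/mapP; exists i.
  by rewrite mem_below -eq_j mnm_lepD.
by rewrite /g -eq_j mnm_addBC.
Qed.

(** Locality in terms of products by symbols in w only: this is what makes it
    stable under all operations on w that commute with these products. *)
Lemma local_uptoP K f : local_upto N K f <->
  forall s t, f s t
    = \sum_(j <- below K) loc_coef j s *: mulsym (loc_sym j s) (res_coef f j) t.
Proof.
have E s t : \sum_(j : 'X_{1..n < (mdeg K).+1} | (j <= K)%MM)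
      scale2 N (hasse_Delta R N j) (inw (Res (scale2 N (subX R j) f))) s t
  = \sum_(j <- below K) loc_coef j s *: mulsym (loc_sym j s) (res_coef f j) t.
  rewrite big_map big_filter; apply: eq_bigr => j _.
  by rewrite scale2_hasse_Delta Res_subX.
by split=> h s t; rewrite h E.
Qed.

Lemma eq_local_upto K f f' : (forall s t, f s t = f' s t) ->
  local_upto N K f' -> local_upto N K f.
Proof.
move=> eq_f; rewrite (_ : f = f') //.
by apply/funext => s; apply/funext => t.
Qed.

(** Substituting the expansion of f into the residue, the orthogonality of the
    binomial matrices leaves only the summand of index l. *)
Lemma res_coef_outside K f l : local_upto N K f -> ~~ (l <= K)%MM ->
  forall t, res_coef f l t = 0.
Proof.
move=> /local_uptoP hf hl t; rewrite /res_coef.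
transitivity (\sum_(i <- below l) \sum_(j <- below K)
  ((-1) ^+ mdeg (l - i)%MM * (mbin l i * mbin (0 + i)%MM j)%N%:R) *:
    mulsym (inl (l - j)%MM) (res_coef f j) t).
  rewrite [LHS]big_seq [RHS]big_seq; apply: eq_bigr => i.
  rewrite mem_below => le_il.
  have -> : f (inr i) = fun t => \sum_(j <- below K)
      loc_coef j (inr i) *: mulsym (inl (i - j)%MM) (res_coef f j) t.
    by apply/funext => t'; rewrite hf.
  rewrite mulsym_sum scaler_sumr; apply: eq_bigr => j _.
  rewrite mulsymZ mulsym_zz scalerA add0m natrM mulrA [_ * (mbin l i)%:R]mulr_natr.
  have [le_ji|nle_ji] := boolP (j <= i)%MM.
    congr (_ *: mulsym (inl _) _ t); apply/mnmP => x.
    rewrite !mnmDE !mnmBE; move: (mnm_lepP le_ji x) (mnm_lepP le_il x); lia.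
  by rewrite /= (mbin_small nle_ji) !mulr0 !scale0r.
rewrite exchange_big big1_seq // => j /andP[_]; rewrite mem_below => le_jK.
rewrite -scaler_suml fin_diff_mbin ifF ?scale0r //.
by apply/negP => le_lj; case/negP: hl; apply: lepm_trans le_jK.
Qed.

Lemma local_upto_mono K K' f : (K <= K')%MM ->
  local_upto N K f -> local_upto N K' f.
Proof.
move=> le_KK' hf; apply/local_uptoP => s t; rewrite (local_uptoP K f).1 //.
rewrite [RHS](bigID (fun j => j <= K)%MM) /= below_widen //.
rewrite [X in _ = _ + X]big1 ?addr0 // => j hj.
by rewrite mulsym_eq0 ?scaler0 //; apply: res_coef_outside hf hj.
Qed.

Lemma local_uptoD K f f' : local_upto N K f -> local_upto N K f' ->
  local_upto N K (fun s t => f s t + f' s t).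
Proof.
move=> /local_uptoP hf /local_uptoP hf'; apply/local_uptoP => s t.
rewrite hf hf' -big_split; apply: eq_bigr => j _ /=.
rewrite -scalerDr -mulsymD; congr (_ *: mulsym _ _ t); apply/funext => t'.
rewrite /res_coef -big_split; apply: eq_bigr => i _.
by rewrite mulsymD scalerDr.
Qed.

Lemma local_uptoZ K (c : R) f : local_upto N K f ->
  local_upto N K (fun s t => c *: f s t).
Proof.
move=> /local_uptoP hf; apply/local_uptoP => s t.
rewrite hf scaler_sumr; apply: eq_bigr => j _.
rewrite scalerA mulrC -scalerA -mulsymZ; congr (_ *: mulsym _ _ t).
apply/funext => t'; rewrite /res_coef scaler_sumr; apply: eq_bigr => i _.
by rewrite mulsymZ !scalerA mulrC.
Qed.

(** An operator power series in w acts linearly and commutes with the symbols in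
    w, so it can be moved into the residues of the local expansion. Boundedness
    of the rows of f makes the sums finite. *)
Lemma local_upto_op_act K (th : 'X_{1..n} -> M -> M) f :
  (forall i, linear (th i)) -> (forall s, lower_bounded (f s)) ->
  local_upto N K f -> local_upto N K (fun s => op_act th (f s)).
Proof.
move=> th_lin f_bd /local_uptoP hf.
have th0 i : th i 0 = 0 by exact: lin0.
have bdZ (c : R) F : lower_bounded F -> lower_bounded (fun t => c *: F t).
  by apply: lower_bounded_comp; rewrite scaler0.
have actG j : op_act th (res_coef f j) = res_coef (fun s => op_act th (f s)) j.
  rewrite /res_coef op_act_sum //; last first.
    by move=> i; apply: bdZ; apply: lower_bounded_mulsym.
  apply/funext => t; apply: eq_bigr => i _; rewrite op_actZ //; last first.
    exact: lower_bounded_mulsym.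
  by rewrite op_act_mulsym.
have G_bd j : lower_bounded (res_coef f j).
  by apply: lower_bounded_sum => i; apply: bdZ; apply: lower_bounded_mulsym.
apply/local_uptoP => s t.
have -> : f s = fun t => \sum_(j <- below K)
    loc_coef j s *: mulsym (loc_sym j s) (res_coef f j) t.
  by apply/funext => t'; rewrite hf.
rewrite op_act_sum //; last by move=> j; apply: bdZ; apply: lower_bounded_mulsym.
apply: eq_bigr => j _; rewrite op_actZ //; last exact: lower_bounded_mulsym.
by rewrite op_act_mulsym // actG.
Qed.

(** The coefficients of z^i Omega_w^k are combinations of the w-regular parts of
    the residues with coefficients binom(i + j, j). Finite differences in i
    isolate the residue of largest index, so all residues vanish by descending
    induction on the index. *)
Lemma local_no_Omega_w K f : local_upto N K f ->
  (forall s k, f s (inr k) = 0) -> forall s t, f s t = 0.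
Proof.
move=> /local_uptoP hf f0.
have G0 d j : (j <= K)%MM -> (mdeg K < mdeg j + d)%N ->
    forall l, res_coef f j (inl l) = 0.
  elim: d j => [|d IH] j le_jK hd l.
    by move: hd; rewrite addn0 ltnNge mdeg_le.
  apply: (can_inj (signK (mdeg j))); rewrite scaler0.
  apply: (can_inj (ksignK N)); rewrite scaler0.
  pose c j' : M :=
    if (j <= l + j')%MM then res_coef f j' (inl (l + j' - j)%MM) else 0.
  (* The diagonal of coefficients z^(l + i) Omega_w^(j + i) involves the residue
     of index j in the single degree l, uniformly in i. *)
  transitivity (\sum_(i <- below j) ((-1) ^+ mdeg (j - i)%MM * (mbin j i)%:R : R)
      *: f (inl (l + i)%MM) (inr (j + i)%MM)); last first.
    by rewrite big1 // => i _; rewrite f0 scaler0.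
  transitivity (\sum_(j' <- below K) \sum_(i <- below j)
     ((-1) ^+ mdeg j' * ksign R N * ((-1) ^+ mdeg (j - i)%MM
       * (mbin j i * mbin ((l + j') + i)%MM j')%N%:R)) *: c j'); last first.
    rewrite exchange_big; apply: eq_bigr => i _.
    rewrite hf scaler_sumr; apply: eq_bigr => j' _ /=.
    have -> : (l + i + j')%MM = (i + (l + j'))%MM.
      by rewrite [(l + i)%MM]addmC addmA.
    rewrite [(j + i)%MM]addmC mnm_lep_add2l /c.
    have -> : (i + (l + j') - (i + j))%MM = (l + j' - j)%MM.
      by rewrite -submDA mnm_addBC.
    rewrite [(l + j' + i)%MM]addmC natrM !scalerA; congr (_ *: _); ring.
  (* Only j' >= j survive, and those with j' > j vanish by induction. *)
  rewrite (bigD1_seq j) ?below_uniq ?mem_below //= [X in _ + X]big1_seq ?addr0.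
    rewrite -scaler_suml -mulr_sumr fin_diff_mbin lepm_refl /c mnm_lepDr mnm_addK.
    have -> : (j - j)%MM = 0%MM by apply/mnmP => x; rewrite mnmBE mnm0E subnn.
    by rewrite mbin0 mulr1 scalerA mulrC.
  move=> j' /andP[neq_j]; rewrite mem_below => le_j'K.
  rewrite -scaler_suml -mulr_sumr fin_diff_mbin.
  case: ifP => [le_jj'|_]; last by rewrite mulr0 scale0r.
  rewrite /c; case: ifP => _; last by rewrite scaler0.
  rewrite IH ?scaler0 //; apply: leq_trans hd _.
  rewrite addnS -addSn leq_add2r ltn_neqAle mdeg_le // andbT.
  apply: contra neq_j; have /submK <- := le_jj'.
  rewrite mdegD -[X in X == _]add0n eqn_add2r eq_sym mdeg_eq0 => /eqP ->.
  by rewrite add0m.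
have {}G0 j l : (j <= K)%MM -> res_coef f j (inl l) = 0.
  by move=> le_jK; apply: (G0 (mdeg K).+1) => //; rewrite addnS ltnS leq_addl.
move=> s [k|k]; last exact: f0.
rewrite hf big1_seq // => j /andP[_]; rewrite mem_below => le_jK.
rewrite mulsymE; case: s => i /=; first by rewrite scaler0.
by case: ifP => _ /=; rewrite ?G0 ?scaler0.
Qed.

End Locality.

(** * Gradings and Koszul twists *)

Section Graded.
Context (R : comPzRingType) (V : gradedLmodType R) (N : int).
Implicit Types (d e p q : int) (u v w : V) (f h : V -> V).

Lemma graded_ind (P : V -> Prop) :
  (forall u v, P u -> P v -> P (u + v)) ->
  (forall d v, has_degree d v -> P v) -> forall v, P v.
Proof.
move=> PD Phom v; have [s [_ ->]] := gcomp_sum v.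
apply: (big_ind P) => [||d _]; [|exact: PD|].
  by apply: (Phom 0); rewrite /has_degree linear0.
by apply: (Phom d); rewrite /has_degree gcompE eqxx.
Qed.

Lemma gcomp_supp v : exists s : seq int, forall d, d \notin s -> gcomp d v = 0.
Proof.
have [s [_ ->]] := gcomp_sum v; exists s => d hd.
rewrite linear_sum big1_seq // => e /andP[_ he]; rewrite gcompE.
by case: eqP => // eq_de; rewrite eq_de he in hd.
Qed.

Lemma koszul_linear : linear (@koszul R V N).
Proof.
move=> c u v; have [s hs] := gcomp_supp u; have [s' hs'] := gcomp_supp v.
have E w : (forall d, d \notin undup (s ++ s') -> gcomp d w = 0) ->
    koszul N w = \sum_(d <- undup (s ++ s')) ksign R (d * N) *: gcomp d w.
  move=> hw; rewrite /koszul (fsum_seq (undup_uniq (s ++ s'))) // => d hd.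
  by rewrite hw // scaler0.
have hu d : d \notin undup (s ++ s') -> gcomp d u = 0.
  by rewrite mem_undup mem_cat negb_or => /andP[/hs].
have hv d : d \notin undup (s ++ s') -> gcomp d v = 0.
  by rewrite mem_undup mem_cat negb_or => /andP[_ /hs'].
rewrite !E //; last first.
  by move=> d hd; rewrite linearP hu // hv // scaler0 addr0.
rewrite scaler_sumr -big_split; apply: eq_bigr => d _ /=.
by rewrite linearP scalerDr !scalerA mulrC.
Qed.

Lemma koszul_homog d v : has_degree d v -> koszul N v = ksign R (d * N) *: v.
Proof.
move=> hv; rewrite /koszul (fsum_single (i0 := d)) ?hv // => e neq_ed.
by rewrite -hv gcompE (negbTE neq_ed) scaler0.
Qed.

Definition op_degree d f : Prop :=
  forall e v, has_degree e v -> has_degree (d + e) (f v).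

Lemma twist_linear f : linear f -> linear (twist N f).
Proof.
by move=> f_lin c u v; rewrite /twist /= koszul_linear f_lin koszul_linear.
Qed.

Lemma twistD f h v :
  twist N (fun u => f u + h u) v = twist N f v + twist N h v.
Proof. by rewrite /twist /= (linD koszul_linear). Qed.

Lemma twist0 : twist N (fun _ => 0) = (fun _ => 0) :> (V -> V).
Proof. by apply/funext => v; rewrite /twist /= (lin0 koszul_linear). Qed.

(** The degrees of the arguments cancel in koszul o f o koszul, so that f need not
    be evaluated at a homogeneous vector. *)
Lemma twist_homog d f v : linear f -> op_degree d f ->
  twist N f v = ksign R (d * N) *: f v.
Proof.
move=> f_lin f_deg; move: v; apply: graded_ind => [u v hu hv|e v hv].
  by rewrite (linD (twist_linear f_lin)) hu hv (linD f_lin) scalerDr.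
rewrite /twist /= (koszul_homog hv) (linZ f_lin) (linZ koszul_linear).
rewrite (koszul_homog (f_deg _ _ hv)) scalerA -ksignD; congr (_ *: _).
apply: eq_ksign; rewrite odd_abszD !odd_abszM odd_abszD.
by case: odd; case: odd; case: odd.
Qed.

Lemma iter_twist_linear b f : linear f -> linear (iter b (twist N) f).
Proof. by move=> f_lin; elim: b => //= b; apply: twist_linear. Qed.

Lemma iter_twist0 b : iter b (twist N) (fun _ => 0) = (fun _ => 0) :> (V -> V).
Proof. by elim: b => //= b ->; rewrite twist0. Qed.

Lemma iter_twistD b f h v :
  iter b (twist N) (fun u => f u + h u) v
  = iter b (twist N) f v + iter b (twist N) h v.
Proof.
elim: b f h v => // b IH f h v; rewrite !iterSr.
by rewrite -IH; congr (iter b _ _ v); apply/funext => u; rewrite twistD.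
Qed.

Definition sym_degree n (s : sym n) : int := if isOmega s then N else 0.

Lemma iter_twist_homog n (t : sym n) d f v : linear f -> op_degree d f ->
  iter (isOmega t) (twist N) f v = ksign R (d * sym_degree t) *: f v.
Proof.
move=> f_lin f_deg; rewrite /sym_degree; case: isOmega => /=.
  exact: twist_homog.
by rewrite mulr0 scale1r.
Qed.

Lemma degZ d (c : R) v : has_degree d v -> has_degree d (c *: v).
Proof. by rewrite /has_degree linearZ => ->. Qed.

Lemma degMn d k v : has_degree d v -> has_degree d (v *+ k).
Proof. by rewrite /has_degree linearMn => ->. Qed.

Lemma deg0 d : has_degree d (0 : V).
Proof. by rewrite /has_degree linear0. Qed.

Section Products.
Context (n : nat).
Implicit Types (A : series1 n (V -> V)) (s t : sym n).

Lemma mul2_inw (F : series2 n (V -> V)) g s t : (forall s t, linear (F s t)) ->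
  mul2 N F (inw g) s t
  = \sum_(u \in [set: sym n])
      mulsym u (fun t' => iter (isOmega t') (twist N) (F s u) (g t')) t.
Proof.
move=> F_lin.
have E (u : sym n * sym n) : mulmon N u.1 u.2 (fun s' t' =>
    iter (isOmega s' + isOmega t') (twist N) (F u.1 u.2) (inw g s' t')) s t
  = if u.1 == s then
      mulsym u.2 (fun t' => iter (isOmega t') (twist N) (F s u.2) (g t')) t
    else 0.
  rewrite mulmon_const => [|s' t' /negbTE hs']; last first.
    by rewrite /inw hs' (lin0 (iter_twist_linear _ (F_lin _ _))).
  case: eqP => // ->; congr (mulsym _ _ t); apply/funext => t'.
  by rewrite /inw eqxx.
rewrite /mul2 (fsum_inj (g := fun x : sym n => (s, x))) => [||[u1 u2] hu].
- by apply: fsum_eq => u; rewrite E eqxx.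
- by move=> u u' [].
by rewrite E /=; case: eqP => // eq_u1; case: (hu u2); rewrite eq_u1.
Qed.

Lemma mul2_op_inw A (f : series2 n V) s t : (forall s, linear (A s)) ->
  mul2 N (op_inw A) f s t
  = \sum_(u \in [set: sym n])
      mulsym u (fun t' => (if isOmega u && isOmega s then ksign R N else 1)
        *: iter (isOmega s + isOmega t') (twist N) (A u) (f s t')) t.
Proof.
move=> A_lin; rewrite /mul2 (fsum_inj (g := fun x : sym n => (inl 0%MM, x))).
- apply: fsum_eq => u; rewrite /mulmon [_.1]/= [_.2]/= mulsym_id.
  have -> : op_inw A (inl 0%MM) u = A u; last by [].
  by apply/funext => v; rewrite /op_inw /inw eqxx.
- by move=> u u' [].
move=> [u1 u2] hu; rewrite /mulmon; do 2![apply: mulsym_eq0 => ?] => /=.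
rewrite (_ : op_inw A u1 u2 = fun _ => 0) ?iter_twist0 ?scaler0 //.
apply/funext => v; rewrite /op_inw /inw /=; case: eqP => // eq_u1.
by case: (hu u2); rewrite eq_u1.
Qed.

Lemma op_inz_linear A : (forall s, linear (A s)) ->
  forall s t, linear (op_inz A s t).
Proof.
move=> A_lin s t c u v; rewrite /op_inz /inz; case: eqP => _.
  exact: A_lin.
by rewrite scaler0 addr0.
Qed.

Lemma mul2_op_inz_inw A g s t : (forall s, linear (A s)) ->
  mul2 N (op_inz A) (inw g) s t = iter (isOmega t) (twist N) (A s) (g t).
Proof.
move=> A_lin; rewrite mul2_inw; last exact: op_inz_linear.
rewrite (fsum_single (i0 := inl 0%MM)) => [|u /negbTE hu].
  rewrite mulsym_id; congr (iter _ _ _ _).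
  by apply/funext => v; rewrite /op_inz /inz eqxx.
rewrite mulsym_eq0 // => t'.
rewrite (_ : op_inz A s u = fun _ => 0) ?iter_twist0 //.
by apply/funext => v; rewrite /op_inz /inz hu.
Qed.

Lemma mul2_op_inw_inz A g s t : (forall s, linear (A s)) ->
  mul2 N (op_inw A) (inz g) s t
  = (if isOmega t && isOmega s then ksign R N else 1)
      *: iter (isOmega s) (twist N) (A t) (g s).
Proof.
move=> A_lin; rewrite mul2_op_inw //.
have E (u : sym n) : mulsym u (fun t' =>
      (if isOmega u && isOmega s then ksign R N else 1)
        *: iter (isOmega s + isOmega t') (twist N) (A u) (inz g s t')) t
   = if u == t then (if isOmega u && isOmega s then ksign R N else 1)
      *: iter (isOmega s) (twist N) (A u) (g s) else 0.
  rewrite mulsym_const => [|t' /negbTE ht']; last first.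
    by rewrite /inz ht' (lin0 (iter_twist_linear _ (A_lin _))) scaler0.
  by rewrite /inz eqxx addn0.
by rewrite (fsum_single (i0 := t)) => [|u /negbTE hu]; rewrite E ?eqxx ?hu.
Qed.

End Products.
End Graded.

(** * The substitution of -w for w *)

Section NegatedSeries.
Context (R : comPzRingType) (n : nat) (N : int) (M : lmodType R).
Implicit Types (i j k m : 'X_{1..n}) (s t : sym n) (v : M).
Implicit Types (F G : series1 n M) (th et : 'X_{1..n} -> M -> M).

(** Multiplication by a power of w does not mix z-type and Omega-type symbols, so
    that signs depending only on the type can be moved across. *)
Lemma op_act_parity th F G t :
  (forall t', isOmega t' = isOmega t -> F t' = G t') ->
  op_act th F t = op_act th G t.
Proof.
move=> eqFG; apply: fsum_eq => i; apply: eq_mulsym_parity => t' ht'.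
by rewrite eqFG.
Qed.

Lemma op_actDl th et F t : (forall i, th i 0 = 0) -> (forall i, et i 0 = 0) ->
  lower_bounded F ->
  op_act (fun i v => th i v + et i v) F t = op_act th F t + op_act et F t.
Proof.
move=> th0 et0 [K FK]; rewrite !(op_actE _ (bounded_reaches t FK)) //.
  rewrite -big_split; apply: eq_bigr => i _; exact: mulsymD.
by move=> i; rewrite th0 et0 addr0.
Qed.

Lemma op_actZl th (c : R) F t : (forall i, th i 0 = 0) -> lower_bounded F ->
  op_act (fun i v => c *: th i v) F t = c *: op_act th F t.
Proof.
move=> th0 [K FK]; rewrite !(op_actE _ (bounded_reaches t FK)) //.
  rewrite scaler_sumr; apply: eq_bigr => i _; exact: mulsymZ.
by move=> i; rewrite th0 scaler0.
Qed.

Definition negz_sign t : R :=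
  match t with
  | inl k => (-1) ^+ mdeg k
  | inr k => (-1) ^+ mdeg k * ksign R (N + 1)
  end.

Lemma negzE F t : negz N F t = negz_sign t *: F t.
Proof. by case: t. Qed.

Lemma negz_sign_sqr t : negz_sign t * negz_sign t = 1.
Proof.
case: t => k /=; first by rewrite -expr2 sqrr_sign.
by rewrite mulrACA ksign_sqr -expr2 sqrr_sign mulr1.
Qed.

Lemma negzK F : negz N (negz N F) = F.
Proof.
by apply/funext => t; rewrite !negzE scalerA negz_sign_sqr scale1r.
Qed.

Lemma negzD F G : negz N (fun t => F t + G t) = fun t => negz N F t + negz N G t.
Proof. by apply/funext => t; rewrite !negzE scalerDr. Qed.

Lemma negzZ (c : R) F : negz N (fun t => c *: F t) = fun t => c *: negz N F t.
Proof. by apply/funext => t; rewrite !negzE !scalerA mulrC. Qed.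

Lemma negz_lower_bounded F : lower_bounded F -> lower_bounded (negz N F).
Proof. by move=> [K FK]; exists K => k hk; rewrite negzE FK ?scaler0. Qed.

Lemma negz_op_act th F : (forall i, linear (th i)) -> lower_bounded F ->
  negz N (op_act th F) = op_act (op_neg th) (negz N F).
Proof.
move=> th_lin [K FK]; apply/funext => t; rewrite negzE.
have th0 i : th i 0 = 0 by exact: lin0.
rewrite (op_actE th0 (bounded_reaches t FK)).
have NFK : bounded K (negz N F) by move=> k hk; rewrite negzE FK ?scaler0.
rewrite (op_actE _ (bounded_reaches t NFK)); last first.
  by move=> i; rewrite /op_neg th0 scaler0.
rewrite scaler_sumr; apply: eq_bigr => i _; rewrite !mulsymE.
case E: mulsym_src => [t'|] /=; last by rewrite scaler0.
rewrite negzE /op_neg (linZ (th_lin _)) scalerA; congr (_ *: _).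
case: t t' E => m [] k //=; first by case: ifP => // /submK <- [<-];
  rewrite mnm_addK mdegD exprD mulrC.
  by case: ifP.
move=> [<-]; rewrite mdegD mulrA; congr (_ * _).
by rewrite addnC exprD mulrA -expr2 sqrr_sign mul1r.
Qed.

Lemma op_negK th : op_neg (op_neg th) = th.
Proof. by apply/funext => i; apply/funext => v; rewrite /op_neg signK. Qed.

Lemma op_neg_const (f : M -> M) :
  op_neg (op_const f) = op_const f :> ('X_{1..n} -> M -> M).
Proof.
apply/funext => i; apply/funext => v; rewrite /op_neg /op_const.
by case: eqP => [->|_]; rewrite ?mdeg0 ?scale1r ?scaler0.
Qed.

End NegatedSeries.

(** * The fields of a vertex algebra as operator series *)

Section CVA.
Context (R : comPzRingType) (n : nat) (N : int) (V : cva_data R n N).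
Implicit Types (a b c v w : V) (i j k m K : 'X_{1..n}) (s t u : sym n).
Implicit Types (p q r : int) (F : series1 n V).

Local Notation Tf := (fun i (v : V) => Top V i v).
Local Notation "x *f y" := (op_mul x y) (at level 40, left associativity).

Lemma Y_lin a s : linear (Y a s).
Proof. by move=> x u v; exact: (linearP (vop a s)). Qed.

Lemma Y_linl s b : linear (fun a => Y a s b). Proof. exact: vop_linear. Qed.

Let T_lin i : linear (Tf i).
Proof. by move=> x u v; exact: (linearP (Top V i)). Qed.

(** The coefficient of s_z w^k in Y(a, z + w), as an operator. *)
Definition Yshift a s k v : V := hasse k (apply1 (Y a) v) s.

Lemma Yshift_eqz a i k v :
  Yshift a (inl i) k v = Y a (inl (i + k)%MM) v *+ mbin (i + k)%MM k.
Proof. by []. Qed.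

Lemma Yshift_lin a s k : linear (Yshift a s k).
Proof.
move=> x u v; rewrite /Yshift /hasse /apply1.
case: s => i; first by rewrite Y_lin mulrnDl scalerMnr.
case: ifP => _; last by rewrite scaler0 addr0.
rewrite Y_lin mulrnDl scalerDr -scalerMnr !scalerA.
by rewrite [x * _]mulrC -!scalerMnr.
Qed.

Lemma YshiftD a a' s k v : Yshift (a + a') s k v = Yshift a s k v + Yshift a' s k v.
Proof.
rewrite /Yshift /hasse /apply1; have D u := linD (Y_linl u v) a a'.
case: s => i; first by rewrite D mulrnDl.
by case: ifP => _; rewrite ?addr0 // D mulrnDl scalerDr.
Qed.

Lemma Y_degree a p s : has_degree p a -> op_degree (p - sym_degree N s) (Y a s).
Proof.
move=> ha e v hv; have := vop_homog s ha hv; rewrite /sym_degree.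
by rewrite addrAC.
Qed.

Lemma Yshift_degree a p s k : has_degree p a ->
  op_degree (p - sym_degree N s) (Yshift a s k).
Proof.
move=> ha e v hv; rewrite /Yshift /hasse /apply1; case: s => i.
  by apply: degMn; exact: (Y_degree (inl (i + k)%MM) ha hv).
case: ifP => _; last exact: deg0.
by apply/degZ/degMn; exact: (Y_degree (inr (i - k)%MM) ha hv).
Qed.

Lemma T_degree i : op_degree 0 (Tf i).
Proof. by move=> e v hv; rewrite add0r; apply: Top_homog. Qed.

Lemma expT_linear s : linear (expT (V := V) s).
Proof.
case: s => i x u v /=; first exact: T_lin.
by rewrite scaler0 addr0.
Qed.

Lemma iter_twist_T (x : nat) i : iter x (twist N) (Tf i) = Tf i.
Proof.
elim: x => //= x ->; apply/funext => v.
by rewrite (twist_homog _ v (T_lin i) (@T_degree i)) mul0r scale1r.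
Qed.

Lemma mul1_expT F : mul1 N (expT (V := V)) F = op_act Tf F.
Proof.
apply/funext => t; rewrite /mul1 (fsum_inj (g := fun i : 'X_{1..n} => inl i)).
- apply: fsum_eq => i; congr (mulsym _ _ t); apply/funext => t'.
  by rewrite /= (iter_twist_T _ i).
- by move=> i j /(congr1 (@symdeg _)).
move=> [i /(_ i)//|i _]; apply: mulsym_eq0 => t'.
by rewrite /= iter_twist0.
Qed.

Lemma mul2_expT (f : series2 n V) s t :
  mul2 N (op_inw (expT (V := V))) f s t = op_act Tf (f s) t.
Proof.
rewrite mul2_op_inw; last exact: expT_linear.
rewrite (fsum_inj (g := fun i : 'X_{1..n} => inl i)).
- apply: fsum_eq => i; congr (mulsym _ _ t); apply/funext => t'.
  by rewrite /= scale1r (iter_twist_T _ i).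
- by move=> i j /(congr1 (@symdeg _)).
move=> [i /(_ i)//|i _]; apply: mulsym_eq0 => t'.
by rewrite /= iter_twist0 scaler0.
Qed.

Lemma mul2_Ysub a F s t :
  mul2 N (Ysub a) (inw F) s t
  = op_act (fun k => iter (isOmega t) (twist N) (op_neg (Yshift a s) k)) F t.
Proof.
rewrite mul2_inw; last first.
  move=> s' [k|k] x u v /=; last by rewrite scaler0 addr0.
  exact: (op_neg_lin (Yshift_lin a s')).
rewrite (fsum_inj (g := fun i : 'X_{1..n} => inl i)).
- by apply: fsum_eq => i; apply: eq_mulsym_parity => t' ->.
- by move=> i j /(congr1 (@symdeg _)).
move=> [i /(_ i)//|i _]; apply: mulsym_eq0 => t'.
by rewrite /= iter_twist0.
Qed.

(** e^{w.T} Y(a, z) e^{-w.T} = Y(a, z + w) as an identity of operator power series,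
    for each coefficient in z. *)
Lemma axiomV4P : axiomV4 V <->
  forall a s, Tf *f (fun i v => Y a s (op_neg Tf i v)) = Yshift a s.
Proof.
have E a b s t : mul2 N (op_inw (expT (V:=V)))
    (mul2 N (op_inz (Y a)) (inw (expNT_at b))) s t
  = zseries (Tf *f (fun i v => Y a s (op_neg Tf i v))) b t.
  rewrite mul2_expT -op_act_zseries; last by move=> i; apply/lin0/T_lin.
  congr (op_act _ _ t); apply/funext => t'.
  rewrite mul2_op_inz_inw; last exact: Y_lin.
  case: t' => k //=; rewrite /expNT_at /= /apply1 /= scaler0.
  by rewrite (lin0 (twist_linear N (Y_lin a s))).
split=> [h a s|h a b s [k|k]]; last 2 first.
- by rewrite E /= h.
- by rewrite E.
apply/funext => k; apply/funext => b.
by have := h a b s (inl k); rewrite E.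
Qed.

(** Y(a, z - w) Y(b, -w) c - Y(Y(a, z) b, -w) c *)
Definition assoc_defect a b c : series2 n V := fun s t =>
  mul2 N (Ysub a) (inw (negz N (apply1 (Y b) c))) s t - YYneg a b c s t.

Lemma assoc_defectE a b c s t : assoc_defect a b c s t =
  op_act (fun k => iter (isOmega t) (twist N) (op_neg (Yshift a s) k))
    (negz N (apply1 (Y b) c)) t
  - negz N (apply1 (Y (Y a s b)) c) t.
Proof. by rewrite /assoc_defect mul2_Ysub. Qed.

(** The signs are those of moving symbols and operators past each other, with
    Y(a)_s of degree p - deg s. *)
Lemma commutatorE a c p r b s t : has_degree p a -> has_degree r c ->
  commutator N p r (Y a) (Y c) b s t
  = ksign R ((p - sym_degree N s) * sym_degree N t) *: Y a s (Y c t b)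
    - ksign R ((p - sym_degree N s) * r) *: Y c t (Y a s b).
Proof.
move=> ha hc; rewrite /commutator; congr (_ - _).
  rewrite mul2_op_inz_inw; last exact: Y_lin.
  by rewrite (iter_twist_homog _ _ _ (Y_lin a s) (Y_degree s ha)).
rewrite mul2_op_inw_inz; last exact: Y_lin.
rewrite (iter_twist_homog _ _ _ (Y_lin c t) (Y_degree t hc)) !scalerA.
congr (_ *: _); rewrite /sym_degree; case: (isOmega s); case: (isOmega t) => /=;
  rewrite -?ksignD ?mulr1 -?ksignD; apply: eq_ksign;
  rewrite ?(odd_abszD, odd_abszM, abszN) /=; by do 3?case: odd.
Qed.

Definition skew_series : Prop :=
  forall p q a b, has_degree p a -> has_degree q b ->
  apply1 (Y a) b
    = fun s => ksign R (p * q) *: op_act Tf (negz N (apply1 (Y b) a)) s.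

Lemma skew_symmetryP : skew_symmetry V <-> skew_series.
Proof.
split=> [h p q a b ha hb|h p q a b ha hb s].
  by apply/funext => s; rewrite /apply1 (h p q a b ha hb) mul1_expT.
by have /(congr1 (fun f => f s)) := h p q a b ha hb; rewrite mul1_expT.
Qed.

Let nT_lin i : linear (op_neg Tf i). Proof. exact: op_neg_lin T_lin i. Qed.
Let T0 i : Tf i 0 = 0. Proof. exact: (lin0 (T_lin i)). Qed.
Let nT0 i : op_neg Tf i 0 = 0. Proof. exact: (lin0 (nT_lin i)). Qed.
Let Y_fam_lin a s i : linear (op_const (Y a s) i).
Proof. exact: op_const_lin (Y_lin a s) i. Qed.
Let nH_lin a s i : linear (op_neg (Yshift a s) i).
Proof. exact: op_neg_lin (Yshift_lin a s) i. Qed.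

Lemma op_mul1 (th : 'X_{1..n} -> V -> V) : (forall i, linear (th i)) ->
  th *f op_const id = th.
Proof. by move=> th_lin; rewrite op_mul_const_r. Qed.

Definition T_inverse : Prop := Tf *f op_neg Tf = op_const id.

(** Y(a, z - w) e^{-w.T} = e^{-w.T} Y(a, z) *)
Definition T_intertwines : Prop := forall a s,
  op_neg (Yshift a s) *f op_neg Tf = fun i v => op_neg Tf i (Y a s v).

Lemma T_inverse_left : T_inverse -> op_neg Tf *f Tf = op_const id.
Proof.
move=> /(congr1 (@op_neg _ _ _)); rewrite op_neg_mul; last exact: T_lin.
by rewrite op_negK op_neg_const.
Qed.

(** The intertwining relation with w replaced by -w. *)
Lemma Yshift_T : T_intertwines -> forall a s,
  Yshift a s *f Tf = fun i v => Tf i (Y a s v).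
Proof.
move=> h a s; have := congr1 (@op_neg _ _ _) (h a s).
by rewrite op_neg_mul ?op_negK.
Qed.

(** e^{w.T} Y(a, z - w) = Y(a, z) e^{w.T}. At z = 0 the left side is the regular
    part of e^{w.T} Y(a, -w), which is how skew-symmetry uses it. *)
Lemma T_neg_Yshift : T_inverse -> T_intertwines -> forall a s,
  Tf *f op_neg (Yshift a s) = fun i v => Y a s (Tf i v).
Proof.
move=> Tinv h a s.
rewrite -(op_mul1 (nH_lin a s)) -(T_inverse_left Tinv).
rewrite (op_mulA (nH_lin a s) nT_lin T_lin) h.
rewrite -(op_mul_const_r _ nT_lin) -(op_mulA nT_lin (Y_fam_lin a s) T_lin).
rewrite op_mulA //; last exact: op_mul_lin (Y_fam_lin a s) T_lin.
by rewrite Tinv op_mul_const_l op_mul_const_l.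
Qed.

Section VertexAxioms.
Hypotheses (hV1 : axiomV1 V) (hV2 : axiomV2 V) (hV3 : axiomV3 V).

Let Y_bd a v : lower_bounded (apply1 (Y a) v). Proof. exact: hV1. Qed.

Lemma Y_vacuum b : apply1 (Y b) (vac V) = zseries Tf b.
Proof. by apply/funext => -[k|k]; rewrite /apply1 hV3. Qed.

Lemma T_vac j : Top V j (vac V) = op_const id j (vac V).
Proof.
by have := hV3 (vac V) (inl j); rewrite hV2 /= => <-.
Qed.

(** The fact that e^{w.T} is invertible is (V4) for the vacuum field; the rest is
    multiplication by e^{w.T} or by its inverse on either side. *)
Lemma axiomV4_translation : axiomV4 V <-> T_inverse /\ T_intertwines.
Proof.
have constY a s :
    (fun i v => Y a s (op_neg Tf i v)) = op_const (Y a s) *f op_neg Tf.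
  by rewrite op_mul_const_l.
split=> [/axiomV4P h|[Tinv h]].
  have Tinv : T_inverse.
    have := h (vac V) (inl 0%MM).
    have -> : (fun i v => Y (vac V) (inl 0%MM) (op_neg Tf i v)) = op_neg Tf.
      by apply/funext => i; apply/funext => v; rewrite hV2 eqxx.
    move=> E; rewrite /T_inverse E.
    apply/funext => k; apply/funext => v.
    by rewrite Yshift_eqz add0m mbinn mulr1n hV2.
  split=> // a s.
  have E : Yshift a s *f Tf = fun i v => Tf i (Y a s v).
    rewrite -h constY -op_mulA //; last exact: op_mul_lin.
    by rewrite -op_mulA // T_inverse_left // op_mul1 // op_mul_const_r.
  have := congr1 (@op_neg _ _ _) E; rewrite op_neg_mul => [->|] //.
  exact: Yshift_lin.
apply/axiomV4P => a s; rewrite constY.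
rewrite -[RHS]op_mul1; last exact: Yshift_lin.
rewrite -Tinv (op_mulA (Yshift_lin a s) T_lin nT_lin) Yshift_T //.
by rewrite op_mulA // op_mul_const_r.
Qed.

(** Skew-symmetry turns Y(b, -w) c into p(b, c) e^{-w.T} Y(c, w) b, and similarly
    with Y(a, z) b in place of b; the intertwining relation then moves e^{-w.T}
    past Y(a, z - w). *)
Lemma defect_commutator : T_intertwines -> skew_series ->
  forall a b c p q r, has_degree p a -> has_degree q b -> has_degree r c ->
  forall s, assoc_defect a b c s
    = fun t => ksign R (q * r)
        *: op_act (op_neg Tf) (commutator N p r (Y a) (Y c) b s) t.
Proof.
move=> hT hS a b c p q r ha hb hc s; apply/funext => t.
have negY d e x y : has_degree d x -> has_degree e y ->
    negz N (apply1 (Y x) y)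
    = fun t => ksign R (d * e) *: op_act (op_neg Tf) (apply1 (Y y) x) t.
  move=> hx hy; rewrite (hS _ _ _ _ hx hy) negzZ negz_op_act ?negzK //.
  exact: negz_lower_bounded.
have YY_bd : lower_bounded (fun t' => Y a s (Y c t' b)).
  apply: (@lower_bounded_comp _ _ _ (Y a s)); last exact: Y_bd.
  exact: (lin0 (Y_lin a s)).
rewrite assoc_defectE.
have -> : (fun k => iter (isOmega t) (twist N) (op_neg (Yshift a s) k))
    = fun k v => ksign R ((p - sym_degree N s) * sym_degree N t)
        *: op_neg (Yshift a s) k v.
  apply/funext => k; apply/funext => v; apply: iter_twist_homog => //.
  by move=> e w hw; apply: degZ; apply: Yshift_degree.
rewrite op_actZl; last 2 first.
- by move=> i; apply/lin0/nH_lin.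
- exact: negz_lower_bounded.
rewrite (negY _ _ _ _ hb hc) op_actZ //; last exact: op_act_lower_bounded.
rewrite op_act_mul // hT.
have hab : has_degree (p - sym_degree N s + q) (Y a s b) by apply: Y_degree.
rewrite (negY _ _ _ _ hab hc).
rewrite [X in _ = _ *: X](_ : _ =
    ksign R ((p - sym_degree N s) * sym_degree N t)
      *: op_act (op_neg Tf) (fun t' => Y a s (Y c t' b)) t
    - ksign R ((p - sym_degree N s) * r)
      *: op_act (op_neg Tf) (apply1 (Y c) (Y a s b)) t).
  rewrite scalerBr; congr (_ - _); last first.
    by rewrite scalerA -ksignD mulrDl addrC.
  by rewrite !scalerA mulrC.
have bdZ (x : R) F : lower_bounded F -> lower_bounded (fun t' => x *: F t').
  by apply: lower_bounded_comp; rewrite scaler0.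
pose F1 t' := ksign R ((p - sym_degree N s) * sym_degree N t') *: Y a s (Y c t' b).
pose F2 t' := - ksign R ((p - sym_degree N s) * r) *: Y c t' (Y a s b).
transitivity (op_act (op_neg Tf) (fun t' => F1 t' + F2 t') t).
  congr (op_act _ _ t); apply/funext => t'.
  by rewrite (commutatorE b s t' ha hc) /F2 scaleNr.
rewrite op_actD //; last 2 first.
- by have [K hK] := YY_bd; exists K => k hk; rewrite /F1 hK ?scaler0.
- exact/bdZ/Y_bd.
rewrite /F2 (op_actZ nT_lin); last exact: (Y_bd c).
rewrite scaleNr; congr (_ - _).
rewrite (@op_act_parity _ _ _ _ F1 (fun t' =>
  ksign R ((p - sym_degree N s) * sym_degree N t) *: Y a s (Y c t' b)))
  ?op_actZ // => t' eq_t.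
by rewrite /F1 /sym_degree eq_t.
Qed.

(** The residues Res_z (z - w)^j of Y(a, z) F(w) are the coefficients of
    Omega_z^j in Y(a, z + w) F(w), as both expand the same powers binomially. *)
Lemma res_Yshift a j F t :
  \sum_(i <- below j) ((-1) ^+ mdeg (j - i)%MM *+ mbin j i) *:
      mulsym (inl (j - i)%MM) (fun t' => Y a (inr i) (F t')) t
  = op_act (Yshift a (inr j)) F t.
Proof.
rewrite -below_rev /op_act (fsum_seq (below_uniq j)) => [|i hi].
  rewrite [LHS]big_seq [RHS]big_seq; apply: eq_bigr => i.
  rewrite mem_below => le_ij.
  have -> : (j - (j - i))%MM = i.
    by rewrite -[X in (X - _)%MM](submK le_ij) addmC mnm_addK.
  rewrite mbin_sub // -mulsymZ; congr (mulsym _ _ t); apply/funext => t'.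
  by rewrite /Yshift /hasse le_ij -scalerMnr scalerMnl.
apply: mulsym_eq0 => t'; rewrite mem_below in hi.
by rewrite /Yshift /hasse (negbTE hi).
Qed.

(** The commutator of Y(a, z) and Y(b, w) is evaluated at the vacuum, where the
    second product contributes nothing to the Omega_z-coefficients. *)
Lemma skew_of_locality : T_inverse -> T_intertwines -> axiomV5 V -> skew_series.
Proof.
move=> Tinv hT hV5 q p b a hb ha; have [K /(_ (vac V)) hK] := hV5 p q a b ha hb.
set f := commutator _ _ _ _ _ _ in hK.
have fE s t : f s t
    = ksign R ((p - sym_degree N s) * sym_degree N t) *: Y a s (zseries Tf b t)
      - ksign R ((p - sym_degree N s) * q) *: Y b t (zseries Tf a s).
  by rewrite /f (commutatorE _ _ _ ha hb) -!Y_vacuum.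
have resE j : res_coef f j = zseries (fun i v => Tf i (Y a (inr j) v)) b.
  rewrite -(Yshift_T hT) -op_act_zseries; last first.
    by move=> i; exact: (lin0 (Yshift_lin a _ i)).
  apply/funext => t; rewrite -res_Yshift; apply: eq_bigr => i _.
  congr (_ *: mulsym _ _ t); apply/funext => t'; rewrite fE /= (lin0 (Y_lin b t')).
  rewrite scaler0 subr0; case: t' => k; rewrite /sym_degree /=.
    by rewrite mulr0 scale1r.
  by rewrite (lin0 (Y_lin a (inr i))) scaler0.
have a_bd : bounded K (apply1 (Y a) b).
  move=> j hj; have := res_coef_outside hK hj (inl 0%MM).
  by rewrite resE /= Top0.
move/local_uptoP: hK => hK.
have sgn0 x : ksign R ((p - sym_degree N (inl 0%MM : sym n)) * x) = ksign R (p * x).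
  by rewrite /sym_degree /= subr0.
apply/funext => -[k|k].
  (* A local series has no terms z^i w^k. *)
  have := hK (inl 0%MM) (inl k); rewrite fE !sgn0 big1 => [|j _]; last first.
    by rewrite /= scaler0.
  rewrite /sym_degree /= mulr0 scale1r Top0 => /subr0_eq E.
  rewrite /apply1 -[LHS](ksignK (p * q)) -E [q * p]mulrC; congr (_ *: _).
  rewrite op_act_zE //.
  have /(congr1 (fun h => h k b)) /= <- := T_neg_Yshift Tinv hT a (inl 0%MM).
  apply: eq_bigr => i _; congr (Tf i _).
  by rewrite /op_neg Yshift_eqz add0m mbinn mulr1n.
(* The terms z^0 Omega_w^k of the local expansion. *)
have := hK (inl 0%MM) (inr k); rewrite fE !sgn0 /=.
rewrite (lin0 (Y_lin a (inl 0%MM))) scaler0 sub0r Top0 => E.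
rewrite -[LHS]/(Y b (inr k) a) -[LHS](ksignK (p * q)) [q * p]mulrC; congr (_ *: _).
rewrite (op_act_OmegaE (K := K)) //; last first.
  by move=> j hj; rewrite negzE a_bd ?scaler0.
rewrite -[LHS]opprK E [RHS](below_shift (i := k)); last first.
  by move=> j hj; rewrite negzE a_bd ?scaler0 // linear0.
rewrite [RHS]big_mkcond -sumrN; apply: eq_bigr => j _ /=.
rewrite add0m mbinn mulr1; case: ifP => [le_kj|_]; last by rewrite scaler0 oppr0.
rewrite resE /= [(k + _)%MM]addmC submK // [RHS]linearZ /=.
rewrite -scaleNr; congr (_ *: _).
by rewrite ksignD /ksign expr1 mulrN1 mulrN.
Qed.

Lemma commutator_bd p r a c b s : has_degree p a -> has_degree r c ->
  lower_bounded (commutator N p r (Y a) (Y c) b s).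
Proof.
move=> ha hc.
have [K [hK hK']] := bounded2 (Y_bd c b) (Y_bd c (Y a s b)).
exists K => k hk; rewrite (commutatorE _ _ _ ha hc).
have /= := hK k hk; rewrite /apply1 => ->.
have /= := hK' k hk; rewrite /apply1 => ->.
by rewrite (lin0 (Y_lin a s)) !scaler0 subr0.
Qed.

Let tH0 a s t k : iter (isOmega t) (twist N) (op_neg (Yshift a s) k) 0 = 0.
Proof. exact/lin0/iter_twist_linear. Qed.

Let negY_bd b c : lower_bounded (negz N (apply1 (Y b) c)).
Proof. exact/negz_lower_bounded/Y_bd. Qed.

Lemma assoc_defectDa a a' b c s t : assoc_defect (a + a') b c s t
  = assoc_defect a b c s t + assoc_defect a' b c s t.
Proof.
rewrite !assoc_defectE addrACA -opprD; congr (_ - _).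
  rewrite -op_actDl //; congr (op_act _ _ t); apply/funext => k; apply/funext => v.
  rewrite -iter_twistD; congr (iter _ _ _ v); apply/funext => w.
  by rewrite /op_neg YshiftD scalerDr.
rewrite !negzE /apply1 -scalerDr; congr (_ *: _).
by rewrite (linD (Y_linl s b)) (linD (Y_linl t c)).
Qed.

Lemma assoc_defectDb a b b' c s t : assoc_defect a (b + b') c s t
  = assoc_defect a b c s t + assoc_defect a b' c s t.
Proof.
rewrite !assoc_defectE addrACA -opprD; congr (_ - _); last first.
  rewrite !negzE /apply1 -scalerDr; congr (_ *: _).
  by rewrite (linD (Y_lin a s)) (linD (Y_linl t c)).
have tH_lin k : linear (iter (isOmega t) (twist N) (op_neg (Yshift a s) k)).
  exact: iter_twist_linear.
transitivity (op_act (fun k => iter (isOmega t) (twist N) (op_neg (Yshift a s) k))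
  (fun t' => negz N (apply1 (Y b) c) t' + negz N (apply1 (Y b') c) t') t).
  congr (op_act _ _ t); rewrite -negzD; congr negz; apply/funext => t'.
  by rewrite /apply1 (linD (Y_linl t' c)).
by rewrite op_actD.
Qed.

Lemma assoc_defectDc a b c c' s t : assoc_defect a b (c + c') s t
  = assoc_defect a b c s t + assoc_defect a b c' s t.
Proof.
rewrite !assoc_defectE addrACA -opprD; congr (_ - _); last first.
  by rewrite !negzE /apply1 -scalerDr (linD (Y_lin _ t)).
have tH_lin k : linear (iter (isOmega t) (twist N) (op_neg (Yshift a s) k)).
  exact: iter_twist_linear.
transitivity (op_act (fun k => iter (isOmega t) (twist N) (op_neg (Yshift a s) k))
  (fun t' => negz N (apply1 (Y b) c) t' + negz N (apply1 (Y b) c') t') t).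
  congr (op_act _ _ t); rewrite -negzD; congr negz; apply/funext => t'.
  by rewrite /apply1 (linD (Y_lin b t')).
by rewrite op_actD.
Qed.

(** For homogeneous a and c the bound of (V5) serves for all b, since the operator
    e^{-w.T} that relates the two series does not change it. Finitely many
    components of a and c then give a common bound. *)
Lemma weak_assoc_of_locality :
  T_intertwines -> skew_series -> axiomV5 V -> weak_associativity V.
Proof.
move=> hT hS hV5; rewrite /weak_associativity.
suff: forall a c, exists K, forall b, local_upto N K (assoc_defect a b c) by [].
apply: graded_ind => [a a' ha ha' c|p a ha].
  have [K hK] := ha c; have [K' hK'] := ha' c; exists (K + K')%MM => b.
  apply: (eq_local_upto (assoc_defectDa a a' b c)); apply: local_uptoD.
    exact: local_upto_mono (mnm_lepD _ _) (hK b).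
  exact: local_upto_mono (mnm_lepDr _ _) (hK' b).
apply: graded_ind => [c c' [K hK] [K' hK']|r c hc].
  exists (K + K')%MM => b.
  apply: (eq_local_upto (assoc_defectDc a b c c')); apply: local_uptoD.
    exact: local_upto_mono (mnm_lepD _ _) (hK b).
  exact: local_upto_mono (mnm_lepDr _ _) (hK' b).
have [K hK] := hV5 p r a c ha hc; exists K.
apply: graded_ind => [b b' hb hb'|q b hb].
  by apply: (eq_local_upto (assoc_defectDb a b b' c)); apply: local_uptoD.
apply: (eq_local_upto (f' := fun s t => ksign R (q * r)
  *: op_act (op_neg Tf) (commutator N p r (Y a) (Y c) b s) t)).
  by move=> s t; rewrite (defect_commutator hT hS ha hb hc).
apply: local_uptoZ; apply: (local_upto_op_act nT_lin) => // s.
exact: commutator_bd.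
Qed.

(** Weak associativity is used with c the vacuum only, where Y(b, w)|0> has no
    Omega_w. *)
Lemma translation_of_weak_assoc :
  weak_associativity V -> T_inverse /\ T_intertwines.
Proof.
move=> hW.
have hT : T_intertwines.
  move=> a s; apply/funext => m; apply/funext => b.
  have [K /(_ b) hK] := hW a (vac V).
  have defE s' t : assoc_defect a b (vac V) s' t =
      zseries (fun i v =>
        ((fun k => iter (isOmega t) (twist N) (op_neg (Yshift a s') k))
          *f op_neg Tf) i v - op_neg Tf i (Y a s' v)) b t.
    have negT x : negz N (zseries Tf x) = zseries (op_neg Tf) x.
      by apply/funext => -[k|k] //=; rewrite scaler0.
    rewrite assoc_defectE !Y_vacuum !negT op_act_zseries //.
    by case: t => k //=; rewrite subr0.
  have hK' : local_upto N K (assoc_defect a b (vac V)) by [].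
  have := local_no_Omega_w hK' _ s (inl m).
  rewrite defE => /(_ _)/subr0_eq; apply=> s' k.
  by rewrite defE.
split=> //.
(* The relation above at b = |0>, where e^{-w.T}|0> = |0>. *)
have TT k i a : Tf k (Tf i a) = Tf (i + k)%MM a *+ mbin (i + k)%MM k.
  have := congr1 (fun h => h k (vac V)) (hT a (inl i)).
  cbv beta; rewrite hV3.
  have -> : (op_neg (Yshift a (inl i)) *f op_neg Tf) k (vac V)
      = (op_neg (Yshift a (inl i)) *f op_const id) k (vac V).
    apply: eq_bigr => j _; congr (op_neg _ j _).
    rewrite /op_neg T_vac /op_const; case: eqP => [->|_]; last by rewrite scaler0.
    by rewrite mdeg0 scale1r.
  rewrite op_mul1 // => /(can_inj (signK (mdeg k))).
  by rewrite Yshift_eqz hV3 => <-.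
apply/funext => m; apply/funext => a; rewrite /op_mul.
transitivity (\sum_(i <- below m) ((-1) ^+ mdeg (m - i)%MM
  * (mbin m i * mbin (0 + i)%MM 0%MM)%N%:R : R) *: Tf m a).
  rewrite [LHS]big_seq [RHS]big_seq; apply: eq_bigr => i.
  rewrite mem_below => le_im; rewrite /op_neg linearZ /= TT submK //.
  by rewrite mbin0 muln1 -scalerA scaler_nat.
rewrite -scaler_suml fin_diff_mbin /op_const.
have -> : (m <= 0)%MM = (m == 0%MM).
  apply/idP/eqP => [/mnm_lepP h|->]; last exact: lepm_refl.
  by apply/mnmP => x; apply/eqP; have := h x; rewrite mnm0E leqn0.
by case: eqP => [->|_]; rewrite ?scale0r // subm0 mbin0 scale1r Top0.
Qed.

(** The commutator is recovered from the associator by multiplication with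
    e^{w.T}; as the bound is uniform in b, homogeneous b suffice. *)
Lemma locality_of_weak_assoc : T_inverse -> T_intertwines -> skew_series ->
  weak_associativity V -> axiomV5 V.
Proof.
move=> Tinv hT hS hW p r a c ha hc; have [K hK] := hW a c; exists K.
have hK' b : local_upto N K (assoc_defect a b c) by exact: hK.
apply: graded_ind => [b b' hb hb'|q b hb].
  apply: eq_local_upto (local_uptoD hb hb') => s t.
  rewrite !(commutatorE _ _ _ ha hc).
  rewrite (linD (Y_lin c t)) !(linD (Y_lin a s)) (linD (Y_lin c t)) !scalerDr.
  by rewrite opprD addrACA.
have def_bd s : lower_bounded (assoc_defect a b c s).
  rewrite (defect_commutator hT hS ha hb hc).
  apply: (@lower_bounded_comp _ _ _ ( *:%R _)); first by rewrite scaler0.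
  by apply: op_act_lower_bounded => //; apply: commutator_bd.
apply: (eq_local_upto (f' := fun s t =>
    ksign R (q * r) *: op_act Tf (assoc_defect a b c s) t)).
  move=> s t; rewrite (defect_commutator hT hS ha hb hc).
  have com_bd := commutator_bd b s ha hc.
  rewrite (op_actZ T_lin); last exact: op_act_lower_bounded.
  rewrite ksignK op_act_mul // Tinv op_act_const //.
by apply: local_uptoZ; apply: (local_upto_op_act T_lin).
Qed.

End VertexAxioms.
End CVA.

Theorem proposition3p3p5 (R : comPzRingType) (n : nat) (N : int)
    (hn : (0 < n)%N) (V : cva_data R n N)
    (hV1 : axiomV1 V) (hV2 : axiomV2 V) (hV3 : axiomV3 V) :
  (axiomV4 V /\ axiomV5 V) <-> (skew_symmetry V /\ weak_associativity V).
Proof.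
split=> [[/(axiomV4_translation hV2)[Tinv hT] hV5]|[/skew_symmetryP hS hW]].
  have hS : skew_series V by apply: skew_of_locality.
  split; first exact/skew_symmetryP.
  exact: weak_assoc_of_locality.
have [Tinv hT] := translation_of_weak_assoc hV2 hV3 hW.
by split; [exact/axiomV4_translation | apply: locality_of_weak_assoc].
Qed.
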